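(* Let $k$ be a perfect field and $I\subseteq k[x_0,\ldots,x_n]$ a homogeneous unmixed radical ideal of dimension $d$, with $d\ge0$. Then \[h_I(m)\le\binom{m+\deg I+d}{d+1}-\binom{m+d}{d+1}\qquad\text{for all } m\ge1.\]
   Context: An ideal is unmixed if all its associated primes have the same dimension. The dimension of a homogeneous ideal is the dimension of the projective variety it defines in $\mathbb P^n(\bar k)$. $h_I(m):=\dim_k(k[x_0,\ldots,x_n]/I)_m$. If $I$ has dimension $d\ge0$ and Hilbert polynomial with leading term $a_dt^d$, then $\deg I:=d!\,a_d$. *)

(* Defs.v *)
From Stdlib Require Import ClassicalEpsilon.
From mathcomp Require Import all_boot all_algebra.
From mathcomp Require Import mpoly.

Set Implicit Arguments.
Unset Strict Implicit.
Unset Printing Implicit Defensive.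

Import GRing.Theory.
Local Open Scope ring_scope.

Definition pb (P : Prop) : bool :=
  if excluded_middle_informative P then true else false.

Definition perfect_field (k : fieldType) : Prop :=
  forall p : nat, p \in [pchar k] -> forall x : k, exists y : k, y ^+ p = x.

(* (K, iota) is an algebraic closure of k: K algebraically closed
   (K : closedFieldType) and algebraic over the image of k. *)
Definition algebraic_over (k : fieldType) (K : closedFieldType)
  (iota : {rmorphism k -> K}) : Prop :=
  forall x : K, exists p : {poly k}, p != 0 /\ root (map_poly iota p) x.

Definition homogp {n : nat} {R : nzRingType} (d : nat) (p : {mpoly R[n]}) : bool :=
  all (fun m => mdeg m == d) (msupp p).

Definition hcomp {n : nat} {R : nzRingType} (d : nat) (p : {mpoly R[n]}) : {mpoly R[n]} :=
  \sum_(m <- msupp p | mdeg m == d) p@_m *: 'X_[m].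

Definition is_ideal {n : nat} {R : comNzRingType} (I : {mpoly R[n]} -> Prop) : Prop :=
  [/\ I 0, (forall f g, I f -> I g -> I (f + g)) & (forall f g, I f -> I (g * f))].

Definition homogeneous_ideal {n : nat} {R : comNzRingType} (I : {mpoly R[n]} -> Prop) : Prop :=
  is_ideal I /\ (forall f d, I f -> I (hcomp d f)).

Definition radical_ideal {n : nat} {R : comNzRingType} (I : {mpoly R[n]} -> Prop) : Prop :=
  is_ideal I /\ (forall f m, I (f ^+ m) -> I f).

Definition prime_ideal {n : nat} {R : comNzRingType} (P : {mpoly R[n]} -> Prop) : Prop :=
  [/\ is_ideal P, ~ P 1 & (forall f g, P (f * g) -> P f \/ P g)].

Definition associated_prime {n : nat} {R : comNzRingType}
  (I P : {mpoly R[n]} -> Prop) : Prop :=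
  prime_ideal P /\ exists f, forall g, P g <-> I (g * f).

(* Projective space P^n(K): points are represented by nonzero vectors of
   K^{n+1}; projective subsets are scaling-invariant sets of such vectors. *)

Definition pset (K : fieldType) (n : nat) := ('I_n.+1 -> K) -> Prop.

Definition psubset {K : fieldType} {n : nat} (A B : pset K n) : Prop :=
  forall v, A v -> B v.

Definition proj_zero {K : fieldType} {n : nat} (S : {mpoly K[n.+1]} -> Prop) : pset K n :=
  fun v => (exists i, v i != 0) /\ (forall f, S f -> f.@[v] = 0).

Definition proj_closed {K : fieldType} {n : nat} (Z : pset K n) : Prop :=
  exists S : {mpoly K[n.+1]} -> Prop,
    (forall f, S f -> exists d, homogp d f) /\ (forall v, Z v <-> proj_zero S v).

Definition proj_irreducible {K : fieldType} {n : nat} (Z : pset K n) : Prop :=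
  [/\ proj_closed Z, (exists v, Z v) &
      forall Y1 Y2 : pset K n, proj_closed Y1 -> proj_closed Y2 ->
        (forall v, Z v -> Y1 v \/ Y2 v) -> psubset Z Y1 \/ psubset Z Y2].

Definition proj_variety {k : fieldType} {K : closedFieldType} (iota : {rmorphism k -> K})
  {n : nat} (I : {mpoly k[n.+1]} -> Prop) : pset K n :=
  proj_zero (fun g => exists f, I f /\ g = map_mpoly iota f).

Definition irr_chain {K : fieldType} {n : nat} (V : pset K n) (d : nat) : Prop :=
  exists Z : nat -> pset K n,
    [/\ (forall i, (i <= d)%N -> proj_irreducible (Z i)),
        (forall i, (i < d)%N -> psubset (Z i) (Z i.+1) /\ ~ psubset (Z i.+1) (Z i)) &
        psubset (Z d) V].

Definition proj_dim {K : fieldType} {n : nat} (V : pset K n) (d : nat) : Prop :=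
  irr_chain V d /\ ~ irr_chain V d.+1.

Definition ideal_dim {k : fieldType} {K : closedFieldType} (iota : {rmorphism k -> K})
  {n : nat} (I : {mpoly k[n.+1]} -> Prop) (d : nat) : Prop :=
  proj_dim (proj_variety iota I) d.

(* unmixed: all associated primes have the same dimension (the possible
   value -1, i.e. empty variety, is covered by quantifying over all d). *)
Definition unmixed {k : fieldType} {K : closedFieldType} (iota : {rmorphism k -> K})
  {n : nat} (I : {mpoly k[n.+1]} -> Prop) : Prop :=
  forall P Q, associated_prime I P -> associated_prime I Q ->
    forall e, ideal_dim iota P e <-> ideal_dim iota Q e.

Definition indep_mod {k : fieldType} {n : nat} (I : {mpoly k[n]} -> Prop) (m r : nat) : Prop :=
  exists p : 'I_r -> {mpoly k[n]},
    (forall i, homogp m (p i)) /\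
    (forall c : 'I_r -> k, I (\sum_(i < r) c i *: p i) -> forall i, c i = 0).

(* h_I(m) = dim_k (k[x]/I)_m, the maximal size of such a family.
   (m+1)^n bounds the number of monomials of degree m in n variables,
   hence bounds this dimension.) *)
Definition hilbert_fun {k : fieldType} {n : nat} (I : {mpoly k[n]} -> Prop) (m : nat) : nat :=
  \max_(r < (m.+1 ^ n).+1 | pb (indep_mod I m r)) r.

Definition hilbert_poly {k : fieldType} {n : nat} (I : {mpoly k[n]} -> Prop)
  (HP : {poly rat}) : Prop :=
  exists m0 : nat, forall m : nat, (m0 <= m)%N -> (hilbert_fun I m)%:R = HP.[m%:R].

(* Main.v *)
(* The bound follows from Chardin's inequality [h_I(m) <= deg I * C(m + d, d)].

   After extending scalars to [L = k(t)], an infinite field over which primes of [k[x]] stay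
   prime, Noether normalization makes [A = L[x]/I] finite over [B = L[y_0, ..., y_d]] for linear
   forms [y_i], and unmixedness makes it torsion free.  A maximal [B]-independent family of [D]
   monomials spans a free module [E] with [b A <= E <= A] for some nonzero [b] in [B], and
   comparing Hilbert functions gives [D = deg I].  Move the coordinates so that [b] does not vanish
   at the point [P = (1 : 0 : ... : 0)], and say that [a] vanishes to order [e] if the
   coordinates of [b a] in [E] do so at [P].  For [a] of degree [m], vanishing to order [m + 1]
   imposes at most [D * C(m + d, d)] linear conditions.  It forces [a = 0]: the coordinates of [b a^s]
   have degree at most [m s + deg b] but vanish to order [(m + 1) s], hence are zero for large [s],
   and [A] is reduced and torsion free.

   Dimensions are controlled by the growth of Hilbert functions: it is bounded below along a chain
   of irreducible closed sets, and bounded above by the number of forms in a Noether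
   normalization. *)

Require Import Defs.
From HB Require Import structures.
From Stdlib Require Import ClassicalEpsilon FunctionalExtensionality.
From mathcomp Require Import all_boot all_order all_algebra.
From mathcomp Require Import ssrcomplements mpoly zify ring lra.

Set Implicit Arguments.
Unset Strict Implicit.
Unset Printing Implicit Defensive.

Import Order.TTheory GRing.Theory Num.Theory.
Local Open Scope ring_scope.

(** * Homogeneous ideals and Hilbert functions *)

(** The dimension in the statement lives over [K], through chains of point sets, while the counting
    runs over [L], and the two fields are never compared. Hilbert functions survive both extensions
    of scalars, which is why [grows] stands in for dimension. [L] is k(t) and not [K] because primes
    of k[x] can split over [K], whereas torsion freeness and reducedness are both read off the
    extended associated primes.

    The quotient A need not be free over B, so the coordinates of b a replace those of a. The price
    is a factor b^2 when two elements are multiplied, removable because b does not vanish at the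
    chosen point, and an excess deg b in degrees, absorbed by a high power of a. *)

Lemma pbP (P : Prop) : reflect P (pb P).
Proof. by rewrite /pb; case: excluded_middle_informative => h; constructor. Qed.

Lemma least_nat (P : nat -> Prop) n : P n ->
  exists m, P m /\ forall i, (i < m)%N -> ~ P i.
Proof.
move=> Pn; have ex : exists m, pb (P m) by exists n; apply/pbP.
case: (ex_minnP ex) => m /pbP Pm min; exists m; split=> // i lt_im /pbP Pi.
by have := min _ Pi; rewrite leqNgt lt_im.
Qed.

Lemma not_forall_exists (T : Type) (P : T -> Prop) : ~ (forall x, P x) -> exists x, ~ P x.
Proof.
move=> h; case: (classic (exists x, ~ P x)) => // h'; case: h => x.
by case: (classic (P x)) => // Px; case: h'; exists x.
Qed.

Section Homogeneous.
Variables (n : nat) (R : nzRingType).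
Implicit Types (p q : {mpoly R[n]}) (d e : nat).

Lemma homogpP d p : reflect (forall m, p@_m != 0 -> mdeg m = d) (homogp d p).
Proof.
apply: (iffP allP) => [h m|h m].
  by rewrite -mcoeff_msupp => /h/eqP.
by rewrite mcoeff_msupp => /h ->.
Qed.

Lemma homogpE d p : homogp d p = (p \is d.-homog for mdeg).
Proof. by []. Qed.

Lemma hcompE d p : hcomp d p = pihomog mdeg d p.
Proof. by []. Qed.

Lemma hcomp_homog d p : homogp d (hcomp d p).
Proof. by rewrite homogpE hcompE pihomogP. Qed.

Lemma hcompD d p q : hcomp d (p + q) = hcomp d p + hcomp d q.
Proof. exact: pihomogD. Qed.

Lemma hcompB d p q : hcomp d (p - q) = hcomp d p - hcomp d q.
Proof. exact: pihomogB. Qed.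

Lemma hcomp0 d : hcomp d (0 : {mpoly R[n]}) = 0.
Proof. exact: pihomog0. Qed.

Lemma hcomp_sum d (T : Type) (r : seq T) (P : pred T) (F : T -> {mpoly R[n]}) :
  hcomp d (\sum_(i <- r | P i) F i) = \sum_(i <- r | P i) hcomp d (F i).
Proof. by rewrite hcompE raddf_sum. Qed.

Lemma hcomp_id d p : homogp d p -> hcomp d p = p.
Proof. by rewrite homogpE => /pihomog_dE. Qed.

Lemma hcomp_ne d e p : homogp d p -> d != e -> hcomp e p = 0.
Proof. by move=> hp ne; rewrite hcompE (pihomog_ne0 ne). Qed.

Lemma mcoeff_hcomp d p m : (hcomp d p)@_m = if mdeg m == d then p@_m else 0.
Proof.
rewrite /hcomp raddf_sum /= big_mkcond /=; case: ifP => md.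
  rewrite {3}[p]mpolyE raddf_sum /=; apply: eq_bigr => m' _.
  rewrite !mcoeffZ !mcoeffX; case: (eqVneq m' m) => [->|_]; first by rewrite md.
  by rewrite mulr0; case: ifP.
apply: big1 => m' _; case: ifP => // md'; rewrite mcoeffZ mcoeffX.
by case: eqP => [e|_]; rewrite ?mulr0 //; rewrite -e md' in md.
Qed.

Lemma hcomp_sumE k p : (msize p <= k)%N -> p = \sum_(d < k) hcomp d p.
Proof. exact: pihomog_partitionE. Qed.

Lemma homogp0 d : homogp d (0 : {mpoly R[n]}).
Proof. by rewrite homogpE rpred0. Qed.

Lemma homogpD d p q : homogp d p -> homogp d q -> homogp d (p + q).
Proof. by rewrite !homogpE => hp hq; apply: rpredD. Qed.

Lemma homogpZ d c p : homogp d p -> homogp d (c *: p).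
Proof. by rewrite !homogpE; apply: dhomogZ. Qed.

Lemma homogpX m : homogp (mdeg m) ('X_[m] : {mpoly R[n]}).
Proof. by rewrite homogpE dhomogX. Qed.

Lemma homogp_X1 i : homogp 1 ('X_i : {mpoly R[n]}).
Proof. by rewrite -(@mdeg1 n i); apply: homogpX. Qed.

Lemma homogp1 : homogp 0 (1 : {mpoly R[n]}).
Proof. by rewrite homogpE dhomog1. Qed.

Lemma homogp_sum d (T : Type) (r : seq T) (P : pred T) (F : T -> {mpoly R[n]}) :
  (forall i, P i -> homogp d (F i)) -> homogp d (\sum_(i <- r | P i) F i).
Proof. by move=> h; rewrite homogpE rpred_sum. Qed.

End Homogeneous.

Section HomogeneousCom.
Variables (n : nat) (R : comNzRingType).
Implicit Types (p q : {mpoly R[n]}) (d e : nat).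

Lemma homogpM d e p q : homogp d p -> homogp e q -> homogp (d + e) (p * q).
Proof. by rewrite !homogpE; apply: dhomogM. Qed.

Lemma homogpXn d p k : homogp d p -> homogp (d * k) (p ^+ k).
Proof. by rewrite !homogpE; apply: dhomogMn. Qed.

Lemma hcompM d p q :
  hcomp d (p * q) = \sum_(i < d.+1) hcomp i p * hcomp (d - i) q.
Proof.
pose k := (maxn (maxn (msize p) (msize q)) d.+1).
have kp : (msize p <= k)%N by rewrite /k !leq_max leqnn.
have kq : (msize q <= k)%N by rewrite /k !leq_max leqnn orbT.
have kd : (d.+1 <= k)%N by rewrite /k leq_max leqnn orbT.
rewrite {1}(hcomp_sumE kp) {1}(hcomp_sumE kq) mulr_suml hcomp_sum.
rewrite (big_ord_widen k (fun i => hcomp i p * hcomp (d - i) q) kd) [RHS]big_mkcond.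
apply: eq_bigr => i _; rewrite mulr_sumr hcomp_sum.
have E (j : 'I_k) : hcomp d (hcomp i p * hcomp j q) =
    if (i + j == d)%N then hcomp i p * hcomp j q else 0.
  have h := homogpM (hcomp_homog i p) (hcomp_homog j q).
  by case: eqP => [<-|/eqP ne]; [rewrite hcomp_id | rewrite (hcomp_ne h)].
rewrite (eq_bigr _ (fun j _ => E j)); rewrite ltnS.
case: leqP => [le_id|lt_di]; last first.
  by apply: big1 => j _; case: eqP => // e; move: lt_di; rewrite -e ltnNge leq_addr.
have lt_dik : (d - i < k)%N by apply: leq_ltn_trans kd; apply: leq_subr.
rewrite (bigD1 (Ordinal lt_dik)) //= subnKC // eqxx big1 ?addr0 // => j ne.
case: eqP => // e; case/negP: ne; apply/eqP/val_inj => /=; by rewrite -e addKn.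
Qed.

Lemma hcompM_homogr d e p q : homogp e q ->
  hcomp d (p * q) = if (e <= d)%N then hcomp (d - e) p * q else 0.
Proof.
move=> hq; rewrite hcompM; case: leqP => [le_ed|lt_de].
  have lt : (d - e < d.+1)%N by rewrite ltnS leq_subr.
  rewrite (bigD1 (Ordinal lt)) //= subKn // (hcomp_id hq) big1 ?addr0 // => i ne.
  rewrite (hcomp_ne (e := (d - i)%N) hq) ?mulr0 //; apply: contraNneq ne => ee.
  by apply/eqP/val_inj; rewrite /= ee subKn // -ltnS.
apply: big1 => i _; rewrite (hcomp_ne (e := (d - i)%N) hq) ?mulr0 //.
by apply: contraTneq lt_de => ->; rewrite -leqNgt leq_subr.
Qed.

End HomogeneousCom.

Section Ideals.
Variables (n : nat) (R : comNzRingType) (I : {mpoly R[n]} -> Prop).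
Hypothesis idI : is_ideal I.
Implicit Types (p q f g : {mpoly R[n]}).

Lemma id0 : I 0. Proof. by case: idI. Qed.
Lemma idD f g : I f -> I g -> I (f + g). Proof. by case: idI => _ h _; apply: h. Qed.
Lemma idMl f g : I f -> I (g * f). Proof. by case: idI => _ _; apply. Qed.
Lemma idMr f g : I f -> I (f * g). Proof. by rewrite mulrC; apply: idMl. Qed.
Lemma idN f : I f -> I (- f). Proof. by rewrite -mulN1r; apply: idMl. Qed.
Lemma idB f g : I f -> I g -> I (f - g). Proof. by move=> hf hg; apply: idD => //; apply: idN. Qed.
Lemma idZ c f : I f -> I (c *: f). Proof. by rewrite -mul_mpolyC; apply: idMl. Qed.
Lemma id_sum (T : Type) (r : seq T) (P : pred T) (F : T -> {mpoly R[n]}) :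
  (forall i, P i -> I (F i)) -> I (\sum_(i <- r | P i) F i).
Proof. by move=> h; elim/big_ind: _ => //; [apply: id0 | move=> *; apply: idD]. Qed.

Lemma idB_sym f g : I (f - g) -> I (g - f).
Proof. by move=> h; rewrite -opprB; apply: idN. Qed.

Lemma idB_trans f g h : I (f - g) -> I (g - h) -> I (f - h).
Proof. by move=> h1 h2; have := idD h1 h2; rewrite addrA subrK. Qed.

Lemma idB_mem f g : I (f - g) -> I g -> I f.
Proof. by move=> h1 h2; rewrite -(subrK g f); apply: idD. Qed.

Lemma idB_mul f f' g g' : I (f - f') -> I (g - g') -> I (f * g - f' * g').
Proof.
move=> hf hg; have -> : f * g - f' * g' = (f - f') * g + f' * (g - g').
  by rewrite mulrBl mulrBr addrA subrK.
by apply: idD; [apply: idMr | apply: idMl].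
Qed.

Lemma idB_add f f' g g' : I (f - f') -> I (g - g') -> I ((f + g) - (f' + g')).
Proof. by move=> hf hg; rewrite opprD addrACA; apply: idD. Qed.

Lemma idB_refl f : I (f - f). Proof. by rewrite subrr; apply: id0. Qed.

Lemma idB_sum (T : Type) (r : seq T) (P : pred T) (F G : T -> {mpoly R[n]}) :
  (forall i, P i -> I (F i - G i)) ->
  I (\sum_(i <- r | P i) F i - \sum_(i <- r | P i) G i).
Proof. by move=> h; rewrite -sumrB; apply: id_sum. Qed.

Lemma idB_exp f g k : I (f - g) -> I (f ^+ k - g ^+ k).
Proof.
move=> h; elim: k => [|k IH]; first by rewrite !expr0 subrr; apply: id0.
by rewrite !exprS; apply: idB_mul.
Qed.

Lemma idXn f k : (0 < k)%N -> I f -> I (f ^+ k).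
Proof. by case: k => // k _ h; rewrite exprS; apply: idMr. Qed.

End Ideals.

Section HomogIdeal.
Variables (n : nat) (R : comNzRingType) (I : {mpoly R[n]} -> Prop).
Hypothesis hI : homogeneous_ideal I.

Lemma hid_hcomp f d : I f -> I (hcomp d f). Proof. by case: hI => _; apply. Qed.

Lemma hid_ideal : is_ideal I. Proof. by case: hI. Qed.

Lemma hid_comps f : (forall d, I (hcomp d f)) -> I f.
Proof.
move=> h; rewrite (hcomp_sumE (leqnn (msize f))).
by apply: id_sum => //; exact: hid_ideal.
Qed.

Lemma hid_notin f : ~ I f -> exists d, ~ I (hcomp d f).
Proof.
by move=> h; apply: not_forall_exists => h'; apply: h; apply: hid_comps.
Qed.

End HomogIdeal.

Section LinearDependency.
Variables (F : fieldType).

Lemma row_dependency (T T' : finType) (A : T -> T' -> F) : (#|T'| < #|T|)%N ->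
  exists c : T -> F, (exists t, c t != 0) /\ forall t', \sum_t c t * A t t' = 0.
Proof.
move=> lt; pose M := \matrix_(i < #|T|, j < #|T'|) A (enum_val i) (enum_val j).
have : kermx M != 0.
  rewrite -mxrank_eq0 mxrank_ker subn_eq0 -ltnNge.
  exact: leq_ltn_trans (rank_leq_col M) lt.
case/rowV0Pn => v /sub_kermxP vM /rV0Pn [i vi].
exists (fun t => v 0 (enum_rank t)); split.
  by exists (enum_val i); rewrite enum_valK.
move=> t'; have /matrixP/(_ 0 (enum_rank t')) := vM.
rewrite !mxE => {2}<-; rewrite (reindex_onto enum_val enum_rank) /=; last first.
  by move=> t _; rewrite enum_rankK.
rewrite (eq_bigl xpredT); last by move=> j; rewrite enum_valK eqxx.
by apply: eq_bigr => j _; rewrite mxE enum_valK enum_rankK.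
Qed.

End LinearDependency.

Section Hilbert.
Variables (F : fieldType) (n : nat) (I : {mpoly F[n]} -> Prop).
Hypothesis idI : is_ideal I.

Definition indep_fam (M : nat) (T : finType) (p : T -> {mpoly F[n]}) : Prop :=
  (forall t, homogp M (p t)) /\
  (forall c : T -> F, I (\sum_t c t *: p t) -> forall t, c t = 0).

Definition span_fam (M : nat) (T : finType) (q : T -> {mpoly F[n]}) : Prop :=
  forall f, homogp M f -> exists c : T -> F, I (f - \sum_t c t *: q t).

(** Steinitz exchange: written in terms of [q], more than [#|T'|] elements have dependent coordinate
    rows. *)
Lemma indep_span_card M (T T' : finType) (p : T -> {mpoly F[n]}) (q : T' -> {mpoly F[n]}) :
  indep_fam M p -> span_fam M q -> (#|T| <= #|T'|)%N.
Proof.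
move=> [hp ip] sq; rewrite leqNgt; apply/negP => lt.
have ch t : {c : T' -> F | I (p t - \sum_t' c t' *: q t')}.
  by apply: constructive_indefinite_description; apply: sq.
pose A t := sval (ch t).
have [c [[t ct] cA]] := row_dependency A lt.
have E : \sum_t c t *: (\sum_t' A t t' *: q t') = 0.
  rewrite (eq_bigr (fun t => \sum_t' (c t * A t t') *: q t')); last first.
    by move=> s _; rewrite scaler_sumr; apply: eq_bigr => s' _; rewrite scalerA.
  rewrite exchange_big /= big1 // => t' _.
  by rewrite -scaler_suml cA scale0r.
case/eqP: ct; apply: ip; rewrite -[X in I X]subr0 -[X in _ - X]E.
apply: (idB_sum idI) => s _; rewrite -scalerBr; apply: (idZ idI).
exact: (svalP (ch s)).
Qed.

(** Exponents range over a full box, so monomials of other degrees occur too, with coefficient 0.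
    The box has [M.+1 ^ n] elements, the cap in [hilbert_fun], which therefore never truncates the
    maximum. *)
Lemma monomials_span M :
  span_fam M (fun g : {ffun 'I_n -> 'I_M.+1} => 'X_[[multinom (g i : nat) | i < n]]).
Proof.
move=> f hf; pose mon (g : {ffun 'I_n -> 'I_M.+1}) := [multinom (g i : nat) | i < n].
exists (fun g => f@_(mon g)).
suff e : f = \sum_g f@_(mon g) *: 'X_[mon g] by rewrite -e subrr; apply: id0.
apply/mpolyP => m; rewrite raddf_sum /=.
have monI : injective mon.
  move=> g g' /mnmP e; apply/ffunP => i; apply/val_inj.
  by have := e i; rewrite !mnmE.
case: (classic (exists g, mon g = m)) => [[g <-]|nex].
  rewrite (bigD1 g) //= mcoeffZ mcoeffX eqxx mulr1 big1 ?addr0 // => g' ne.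
  by rewrite mcoeffZ mcoeffX (inj_eq monI) (negbTE ne) mulr0.
rewrite big1 => [|g _]; last first.
  rewrite mcoeffZ mcoeffX; case: eqP => [e|_]; last by rewrite mulr0.
  by case: nex; exists g.
apply/eqP/negP => /negP fm; apply: nex.
have dm := elimT (homogpP _ _) hf _ fm.
have lt i : (m i < M.+1)%N.
  by rewrite ltnS -dm mdegE (bigD1 i) //= leq_addr.
exists [ffun i => Ordinal (lt i)]; apply/mnmP => i; by rewrite mnmE ffunE.
Qed.

Lemma indep_fam_le M (T : finType) (p : T -> {mpoly F[n]}) :
  indep_fam M p -> (#|T| <= hilbert_fun I M)%N.
Proof.
move=> ip; have le := indep_span_card ip (@monomials_span M).
have {le} lt : (#|T| < (M.+1 ^ n).+1)%N.
  by move: le; rewrite card_ffun !card_ord ltnS.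
have ind : pb (indep_mod I M #|T|).
  apply/pbP; exists (fun i => p (enum_val i)); case: ip => hp ip; split => // c Ic i.
  have := ip (fun t => c (enum_rank t)) _ (enum_val i); rewrite enum_valK; apply.
  move: Ic; rewrite (reindex_onto (fun t => enum_rank t) (fun i => enum_val i)) /=; last first.
    by move=> j _; rewrite enum_valK.
  rewrite (eq_bigl xpredT) => [|j]; last by rewrite enum_rankK eqxx.
  by under eq_bigr => t _ do rewrite enum_rankK.
exact: (@leq_bigmax_cond _ _ (fun r : 'I_(M.+1 ^ n).+1 => r : nat) (Ordinal lt)).
Qed.

Lemma indep_hilbert M : exists p : 'I_(hilbert_fun I M) -> {mpoly F[n]}, indep_fam M p.
Proof.
have ind0 : pb (indep_mod I M (ord0 : 'I_(M.+1 ^ n).+1)).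
  by apply/pbP; exists (fun=> 0); split => [i|c _ []] //; apply: homogp0.
have := @eq_bigmax_cond _ [pred r : 'I_(M.+1 ^ n).+1 | pb (indep_mod I M r)]
  (fun r : 'I_(M.+1 ^ n).+1 => r : nat).
case; first by apply/card_gt0P; exists ord0.
by move=> r /pbP [p hp]; rewrite /hilbert_fun => ->; exists p.
Qed.

Lemma basis_hilbert M : exists p : 'I_(hilbert_fun I M) -> {mpoly F[n]},
  indep_fam M p /\ span_fam M p.
Proof.
have [p ip] := indep_hilbert M; exists p; split => // f hf.
(* Adjoining [f] to a maximal independent family creates a relation, and [f] must occur in it. *)
pose q (t : unit + 'I_(hilbert_fun I M)) := if t is inr i then p i else f.
have nq : ~ indep_fam M q.
  by move/indep_fam_le; rewrite card_sum card_unit card_ord ltnn.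
have hq t : homogp M (q t) by case: t => [?|i] //=; case: ip.
have : ~ forall c : _ -> F, I (\sum_t c t *: q t) -> forall t, c t = 0.
  by move=> h; apply: nq.
case/not_forall_exists => c nc; have [Ic nc'] := imply_to_and _ _ nc.
case/not_forall_exists: nc' => t ct.
have sumE : \sum_t c t *: q t = c (inl tt) *: f + \sum_i c (inr i) *: p i.
  by rewrite big_sumType /= (bigD1 tt) //= big1 ?addr0 // => [[]].
have cN : c (inl tt) != 0.
  apply/eqP => cN; apply: ct; case: t => [[]|i] //.
  by case: ip => _ /(_ (c \o inr)); apply; move: Ic; rewrite sumE cN scale0r add0r.
exists (fun i => - ((c (inl tt))^-1 * c (inr i))).
have := idZ idI (c (inl tt))^-1 Ic; rewrite sumE scalerDr scalerA mulVf // scale1r.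
rewrite scaler_sumr; congr (I (_ + _)); rewrite -sumrN; apply: eq_bigr => i _.
by rewrite scaleNr opprK scalerA.
Qed.

Lemma span_fam_ge M (T : finType) (q : T -> {mpoly F[n]}) :
  span_fam M q -> (hilbert_fun I M <= #|T|)%N.
Proof.
by have [p ip] := indep_hilbert M; move/(indep_span_card ip); rewrite card_ord.
Qed.

End Hilbert.

(** * Growth of Hilbert functions *)

Section Subst.
Variables (F : comNzRingType) (s n : nat) (y : 'I_s -> {mpoly F[n]}).

Definition subst (q : {mpoly F[s]}) : {mpoly F[n]} := mmap (@mpolyC n F) y q.

HB.instance Definition _ := GRing.RMorphism.copy subst (mmap (@mpolyC n F) y).

Lemma substM p q : subst (p * q) = subst p * subst q. Proof. exact: rmorphM. Qed.

Lemma subst_sum (T : Type) (r : seq T) (P : pred T) (f : T -> {mpoly F[s]}) :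
  subst (\sum_(i <- r | P i) f i) = \sum_(i <- r | P i) subst (f i).
Proof. exact: raddf_sum. Qed.

Lemma substZ c q : subst (c *: q) = c *: subst q.
Proof. by rewrite /subst mmapZ mul_mpolyC. Qed.

Lemma substC c : subst c%:MP = c%:MP.
Proof. by rewrite /subst mmapC. Qed.

Lemma substX m : subst 'X_[m] = \prod_i y i ^+ m i.
Proof. by rewrite /subst mmapX. Qed.

Lemma substU i : subst 'X_i = y i.
Proof. by rewrite /subst mmapX mmap1U. Qed.

Lemma substE q : subst q = \sum_(m <- msupp q) q@_m *: \prod_i y i ^+ m i.
Proof.
by rewrite {1}[q]mpolyE raddf_sum; apply: eq_bigr => m _; rewrite /= substZ substX.
Qed.

Lemma homogp_prod_exp (e : 'I_s -> nat) (m : 'I_s -> nat) : (forall i, homogp (e i) (y i)) ->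
  homogp (\sum_i e i * m i) (\prod_i y i ^+ m i).
Proof.
move=> hy; elim/big_rec2: _ => [|i d p _ hp]; first exact: homogp1.
by apply: homogpM => //; apply: homogpXn.
Qed.

Hypothesis hy : forall i, homogp 1 (y i).

Lemma subst_homog D q : homogp D q -> homogp D (subst q).
Proof.
move=> /homogpP hq; rewrite substE big_seq; apply: homogp_sum => m.
rewrite mcoeff_msupp => /hq <-; apply: homogpZ.
have := homogp_prod_exp m hy; rewrite mdegE.
by under eq_bigr => i _ do rewrite mul1n.
Qed.

Lemma hcomp_subst D q : hcomp D (subst q) = subst (hcomp D q).
Proof.
pose k := maxn (msize q) D.+1.
have kq : (msize q <= k)%N by rewrite leq_max leqnn.
have kD : (D < k)%N by rewrite /k leq_max leqnn orbT.
rewrite {1}(hcomp_sumE kq) raddf_sum hcomp_sum (bigD1 (Ordinal kD)) //=.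
rewrite hcomp_id; last exact/subst_homog/hcomp_homog.
rewrite big1 ?addr0 // => i ne; apply: (@hcomp_ne _ _ i); first exact/subst_homog/hcomp_homog.
by apply: contraNneq ne => e; apply/eqP/val_inj.
Qed.

End Subst.

Lemma subst_id (F : comNzRingType) n (q : {mpoly F[n]}) : subst (fun i => 'X_i) q = q.
Proof.
rewrite substE [RHS]mpolyE; apply: eq_bigr => m _; congr (_ *: _).
by rewrite mpolyXE_id.
Qed.

Section SumIdeal.
Variables (F : comNzRingType) (n : nat) (J : {mpoly F[n]} -> Prop).

Definition sumI s (y : 'I_s -> {mpoly F[n]}) : {mpoly F[n]} -> Prop :=
  fun f => exists a : 'I_s -> {mpoly F[n]}, J (f - \sum_i a i * y i).

Definition sumI1 (f : {mpoly F[n]}) : {mpoly F[n]} -> Prop :=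
  sumI (fun _ : 'I_1 => f).

Hypothesis idJ : is_ideal J.

Section Gens.
Variables (s : nat) (y : 'I_s -> {mpoly F[n]}).

Lemma sumI_ideal : is_ideal (sumI y).
Proof.
split.
- exists (fun=> 0); rewrite big1 => [|i _]; last by rewrite mul0r.
  by rewrite subr0; apply: id0.
- move=> f g [a ha] [b hb]; exists (fun i => a i + b i).
  under eq_bigr => i _ do rewrite mulrDl.
  by rewrite big_split opprD addrACA; apply: idD.
- move=> f g [a ha]; exists (fun i => g * a i).
  under eq_bigr => i _ do rewrite -mulrA.
  by rewrite -mulr_sumr -mulrBr; apply: idMl.
Qed.

Lemma sumI_sub f : J f -> sumI y f.
Proof.
move=> h; exists (fun=> 0); rewrite big1 => [|i _]; last by rewrite mul0r.
by rewrite subr0.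
Qed.

Lemma sumI_gen i : sumI y (y i).
Proof.
exists (fun j => (j == i)%:R); rewrite (bigD1 i) //= eqxx mul1r big1.
  by rewrite addr0 subrr; apply: id0.
by move=> j /negbTE ->; rewrite mul0r.
Qed.

Lemma sumI_min (J' : {mpoly F[n]} -> Prop) : is_ideal J' ->
  (forall f, J f -> J' f) -> (forall i, J' (y i)) -> forall f, sumI y f -> J' f.
Proof.
move=> idJ' sub hy f [a ha]; apply: (idB_mem idJ' (sub _ ha)).
by apply: id_sum => // i _; apply: idMl.
Qed.

End Gens.

Lemma sumI1P f g : sumI1 f g <-> exists a, J (g - a * f).
Proof.
split=> [[a]|[a ha]]; first by rewrite big_ord1; exists (a ord0).
by exists (fun=> a); rewrite big_ord1.
Qed.

End SumIdeal.

Lemma sumI_homog (F : comNzRingType) n (J : {mpoly F[n]} -> Prop) s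
  (y : 'I_s -> {mpoly F[n]}) (e : 'I_s -> nat) :
  homogeneous_ideal J -> (forall i, homogp (e i) (y i)) -> homogeneous_ideal (sumI J y).
Proof.
move=> hJ hy; split; first exact: (sumI_ideal (hid_ideal hJ)).
move=> f d [a /(hid_hcomp hJ d)]; rewrite hcompB hcomp_sum => h.
exists (fun i => if (e i <= d)%N then hcomp (d - e i) (a i) else 0).
rewrite (eq_bigr (fun i => hcomp d (a i * y i))) // => i _.
by rewrite (hcompM_homogr _ _ (hy i)); case: leqP; rewrite ?mul0r.
Qed.

Lemma sumI_mono (F : comNzRingType) n (J J' : {mpoly F[n]} -> Prop) s
  (y : 'I_s -> {mpoly F[n]}) :
  (forall f, J f -> J' f) -> forall f, sumI J y f -> sumI J' y f.
Proof. by move=> sub f [a ha]; exists a; apply: sub. Qed.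

Section Growth.
Variables (F : fieldType) (n : nat).
Implicit Types (J : {mpoly F[n]} -> Prop).

(* For homogeneous [J] this says that the projective dimension of [J] is at least [r]. *)
Definition grows (r : nat) J : Prop :=
  exists e, (0 < e)%N /\ forall M, ('C(M + r, r) <= hilbert_fun J (e * M))%N.

(* When [y] consists of linear forms and [J] is homogeneous, the graded Nakayama lemma turns this
   into finiteness of the quotient by [J] over the ring of polynomials in [y]. *)
Definition fin_over J s (y : 'I_s -> {mpoly F[n]}) : Prop :=
  exists E, forall i, sumI J y ('X_i ^+ E).

Definition indep_over J s (y : 'I_s -> {mpoly F[n]}) : Prop :=
  forall q, J (subst y q) -> q = 0.

Definition lin_forms s (y : 'I_s -> {mpoly F[n]}) : Prop := forall i, homogp 1 (y i).

(** Testing forms [a] only is enough, since Hilbert functions count forms. *)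
Definition nzd J (f : {mpoly F[n]}) : Prop :=
  forall M a, homogp M a -> J (f * a) -> J a.

Lemma hilbert_sub J J' M : is_ideal J -> is_ideal J' -> (forall f, J f -> J' f) ->
  (hilbert_fun J' M <= hilbert_fun J M)%N.
Proof.
move=> idJ idJ' sub; have [p [hp ip]] := indep_hilbert J' M.
rewrite -[X in (X <= _)%N]card_ord; apply: (indep_fam_le idJ (p := p)) => //.
by split=> // c /sub; apply: ip.
Qed.

(** Multiplication by [f] embeds degree [M] of the quotient by [J] into the part of degree [e + M]
    that dies in the quotient by [J']. *)
Lemma hilbert_addl J J' M e f : is_ideal J -> is_ideal J' -> (forall g, J g -> J' g) ->
  J' f -> homogp e f -> nzd J f ->
  (hilbert_fun J M + hilbert_fun J' (e + M) <= hilbert_fun J (e + M))%N.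
Proof.
move=> idJ idJ' sub J'f hf nf.
have [p [hp ip]] := indep_hilbert J M; have [q [hq iq]] := indep_hilbert J' (e + M).
pose u (t : 'I_(hilbert_fun J M) + 'I_(hilbert_fun J' (e + M))) :=
  match t with inl i => f * p i | inr j => q j end.
rewrite -{1}[hilbert_fun J M]card_ord -{1}[hilbert_fun J' _]card_ord -card_sum.
apply: (indep_fam_le idJ (p := u)) => //; split=> [[i|j] /=|c].
- exact: homogpM.
- exact: hq.
rewrite big_sumType /=.
have -> : \sum_i c (inl i) *: (f * p i) = f * \sum_i c (inl i) *: p i.
  by rewrite mulr_sumr; apply: eq_bigr => i _; rewrite scalerAr.
move=> Jc; have cr j : c (inr j) = 0.
  apply: (iq (c \o inr)); rewrite -[X in J' X](addKr (f * \sum_i c (inl i) *: p i)).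
  apply: (idD idJ'); last exact: sub.
  by apply: (idN idJ'); apply: idMr.
have cl i : c (inl i) = 0.
  apply: (ip (c \o inl)); apply: (nf M).
    by apply: homogp_sum => k _; apply: homogpZ.
  move: Jc; rewrite [X in _ + X]big1 ?addr0 // => j _; by rewrite cr scale0r.
by case.
Qed.

(** Each multiplication by [f ^+ e'] adds a value of the Hilbert function of [J'], and Pascal's rule
    sums these lower bounds. The power [e'] makes the step [e * e'] a multiple of the step at which
    [J'] is controlled. *)
Lemma growsS J J' r e f : is_ideal J -> is_ideal J' -> (forall g, J g -> J' g) ->
  J' f -> homogp e f -> (0 < e)%N -> nzd J f -> grows r J' -> grows r.+1 J.
Proof.
move=> idJ idJ' sub J'f hf e0 nf [e' [e'0 gr]].
have hf' : homogp (e * e') (f ^+ e') by apply: homogpXn.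
have J'f' : J' (f ^+ e') by apply: idXn.
have nf' : nzd J (f ^+ e').
  elim: {gr e'0 J'f' hf'} e' => [|k IH] M a ha; first by rewrite expr0 mul1r.
  rewrite exprS -mulrA => h; apply: (IH M) => //.
  by apply: (nf (e * k + M)%N) h; apply: homogpM => //; exact: homogpXn.
exists (e * e')%N; split; first by rewrite muln_gt0 e0.
elim=> [|M IH].
  rewrite muln0 add0n binn; apply: leq_trans (hilbert_sub 0 idJ idJ' sub).
  by have := gr 0; rewrite muln0 add0n binn.
rewrite mulnS addSn binS.
apply: leq_trans (hilbert_addl _ idJ idJ' sub J'f' hf' nf'); apply: leq_add => //.
have := gr (e * M.+1)%N; rewrite -mulnS mulnA [(e' * e)%N]mulnC; apply: leq_trans.
by apply: leq_bin2l; rewrite addnS -addSn leq_add2r leq_pmull.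
Qed.

Definition monos s d : seq 'X_{1..s} := [seq s2m (tval t) | t <- enum (basis s d)].

Lemma mem_monos s d m : (m \in monos s d) = (mdeg m == d).
Proof. by rewrite basis_cover. Qed.

Lemma card_monos s d : #|{: seq_sub (monos s.+1 d)}| = 'C(d + s, s).
Proof.
rewrite card_seq_sub; last exact: uniq_basis.
by rewrite size_basis -(bin_sub (leq_addr s d)) addKn.
Qed.

Lemma indep_over_hilbert J r (y : 'I_r.+1 -> {mpoly F[n]}) M :
  is_ideal J -> lin_forms y -> indep_over J y -> ('C(M + r, r) <= hilbert_fun J M)%N.
Proof.
move=> idJ hy iy; rewrite -card_monos.
apply: (indep_fam_le idJ (p := fun t : seq_sub (monos r.+1 M) => subst y 'X_[ssval t])) => //.
split=> [[m /= mM]|c].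
  apply: subst_homog => //; move: mM; rewrite mem_monos => /eqP <-; exact: homogpX.
rewrite -(eq_bigr _ (fun t _ => substZ y (c t) _)) -raddf_sum /= => /iy /mpolyP c0 t.
have := c0 (ssval t); rewrite mcoeff0 raddf_sum /= (bigD1 t) //= mcoeffZ mcoeffX eqxx mulr1.
rewrite big1 ?addr0 // => t' ne; rewrite mcoeffZ mcoeffX (inj_eq val_inj).
by rewrite (negbTE ne) mulr0.
Qed.

Lemma indep_over_grows J r (y : 'I_r.+1 -> {mpoly F[n]}) :
  is_ideal J -> lin_forms y -> indep_over J y -> grows r J.
Proof.
by move=> idJ hy iy; exists 1%N; split=> // M; rewrite mul1n; apply: (indep_over_hilbert (y := y)).
Qed.

Section Finite.
Variables (J : {mpoly F[n]} -> Prop) (s : nat) (y : 'I_s -> {mpoly F[n]}) (E : nat).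
Hypotheses (hJ : homogeneous_ideal J) (hy : lin_forms y).
Hypothesis finE : forall i, sumI J y ('X_i ^+ E).
Let idJ := hid_ideal hJ.

Definition boxm (g : {ffun 'I_n -> 'I_E}) : 'X_{1..n} := [multinom (g i : nat) | i < n].

(** Graded Nakayama, by induction on the degree: a monomial outside the box is divisible by some
    ['X_i ^+ E], hence is modulo [J] a combination of the [y j] with coefficients of lower degree.
    As [M - mdeg (boxm g)] is truncated, the vanishing of [b g] for too large a box monomial is
    stated apart. *)
Lemma fin_over_gen M f : homogp M f ->
  exists b : {ffun 'I_n -> 'I_E} -> {mpoly F[s]},
    (forall g, homogp (M - mdeg (boxm g)) (b g) /\ ((M < mdeg (boxm g))%N -> b g = 0)) /\
    J (f - \sum_g subst y (b g) * 'X_[boxm g]).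
Proof.
elim/ltn_ind: M f => M IH f hf.
pose P f := exists b : {ffun 'I_n -> 'I_E} -> {mpoly F[s]},
    (forall g, homogp (M - mdeg (boxm g)) (b g) /\ ((M < mdeg (boxm g))%N -> b g = 0)) /\
    J (f - \sum_g subst y (b g) * 'X_[boxm g]).
have P0 : P 0.
  exists (fun=> 0); split; first by move=> g; split=> //; apply: homogp0.
  by rewrite big1 ?subr0 => [|g _]; [apply: id0 | rewrite raddf0 mul0r].
have PD f1 f2 : P f1 -> P f2 -> P (f1 + f2).
  move=> [b1 [hb1 j1]] [b2 [hb2 j2]]; exists (fun g => b1 g + b2 g); split=> [g|].
    have [h1 h1'] := hb1 g; have [h2 h2'] := hb2 g; split; first exact: homogpD.
    by move=> lt; rewrite h1' // h2' // addr0.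
  under eq_bigr => g _ do rewrite raddfD /= mulrDl.
  by rewrite big_split /=; exact: (idB_add idJ j1 j2).
have PZ c f1 : P f1 -> P (c *: f1).
  move=> [b1 [hb1 j1]]; exists (fun g => c *: b1 g); split=> [g|].
    have [h1 h1'] := hb1 g; split; first exact: homogpZ.
    by move=> lt; rewrite h1' // scaler0.
  under eq_bigr => g _ do rewrite substZ -scalerAl.
  by rewrite -scaler_sumr -scalerBr; apply: idZ.
have PJ f1 f2 : J (f1 - f2) -> P f2 -> P f1.
  move=> j [b [hb j2]]; exists b; split=> //; exact: (idB_trans idJ j j2).
suff PX m : mdeg m = M -> P 'X_[m].
  change (P f); rewrite [f]mpolyE big_seq; elim/big_ind: _ => // m.
  by rewrite mcoeff_msupp => /(elimT (homogpP _ _) hf) /PX; apply: PZ.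
move=> dm; case: (classic (forall i, (m i < E)%N)) => [lt|/not_forall_exists [i /negP]].
  pose g0 : {ffun 'I_n -> 'I_E} := [ffun i => Ordinal (lt i)].
  have eg0 : boxm g0 = m by apply/mnmP => i; rewrite mnmE ffunE.
  exists (fun g => (g == g0)%:R); split=> [g|].
    case: eqP => [->|_]; last by split=> //; apply: homogp0.
    by rewrite eg0 dm subnn ltnn; split=> //; apply: homogp1.
  rewrite (bigD1 g0) //= eqxx rmorph1 mul1r eg0 big1 ?addr0 ?subrr; first exact: id0.
  by move=> g /negbTE ->; rewrite raddf0 mul0r.
rewrite -leqNgt => Emi; have [a ja] := finE i.
have mE : m = (U_(i) *+ E + (m - U_(i) *+ E))%MM.
  rewrite addmC submK //; apply/mnm_lepP => j; rewrite mulmnE mnm1E.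
  by case: eqP => [<-|_]; rewrite ?mul1n ?mul0n.
have XE : 'X_[m] = 'X_i ^+ E * 'X_[m - U_(i) *+ E] :> {mpoly F[n]}.
  by rewrite mpolyXn -mpolyXD -mE.
have {ja} := idMr idJ 'X_[m - U_(i) *+ E] ja.
rewrite mulrBl -XE mulr_suml => /(hid_hcomp hJ M).
rewrite hcompB (hcomp_id (d := M)); last by rewrite -dm; apply: homogpX.
(* In degree 0, possible here when [E = 0], products with linear forms contribute nothing and the
   monomial lies in [J]. *)
rewrite hcomp_sum; case: (posnP M) => [M0|Mpos].
  rewrite big1 => [j|j _]; first by apply: (PJ _ 0) => //.
  by rewrite mulrAC (hcompM_homogr _ _ (hy j)) M0.
move=> j; apply: PJ j _; elim/big_ind: _ => // j _.
rewrite mulrAC (hcompM_homogr _ _ (hy j)) Mpos.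
have lt : (M - 1 < M)%N by rewrite subn1 prednK.
have [b [hb jb]] := IH _ lt _ (hcomp_homog (M - 1) (a j * 'X_[(m - U_(i) *+ E)%MM])).
exists (fun g => b g * 'X_j); split=> [g|].
  have [h1 h2] := hb g; case: (leqP M (mdeg (boxm g))) => [le|lt'].
    rewrite h2 ?mul0r; first by split=> //; apply: homogp0.
    by apply: leq_trans le.
  split; last by move/ltnW; rewrite leqNgt lt'.
  have -> : (M - mdeg (boxm g) = (M - 1 - mdeg (boxm g)) + 1)%N by lia.
  by apply: homogpM => //; apply: homogp_X1.
have := idMr idJ (y j) jb; rewrite mulrBl; congr (J (_ - _)); rewrite mulr_suml.
apply: eq_bigr => g _.
by rewrite rmorphM /= substU mulrAC.
Qed.

(** The cutoff [K] makes the index type independent of [M], so that these counts can be summed over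
    [M]. *)
Lemma fin_over_hilbert K M : (M <= K)%N ->
  (hilbert_fun J M <= #|[pred x : {ffun 'I_n -> 'I_E} * 'X_{1..s < K.+1} |
                         mdeg (boxm x.1) + mdeg x.2 == M]|)%N.
Proof.
move=> leMK; set A := [pred x | _]; rewrite -card_sig.
pose u1 (x : {x in A}) := (sval x).1; pose u2 (x : {x in A}) : 'X_{1..s} := (sval x).2.
apply: (span_fam_ge idJ (q := fun x : {x in A} => subst y 'X_[u2 x] * 'X_[boxm (u1 x)])).
move=> f hf; have [b [hb jb]] := fin_over_gen hf.
exists (fun x => (b (u1 x))@_(u2 x)).
suff <- : \sum_g subst y (b g) * 'X_[boxm g] =
  \sum_(x : {x in A}) (b (u1 x))@_(u2 x) *: (subst y 'X_[u2 x] * 'X_[boxm (u1 x)]).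
  by [].
have sz g : (msize (b g) <= K.+1)%N.
  rewrite msizeE; apply/bigmax_leqP_seq => m; rewrite mcoeff_msupp => bm _.
  have [/homogpP h _] := hb g; rewrite (h _ bm) ltnS; apply: leq_trans leMK; exact: leq_subr.
rewrite (eq_bigr (fun g => \sum_(m : 'X_{1..s < K.+1})
  (b g)@_m *: (subst y 'X_[m] * 'X_[boxm g]))); last first.
  move=> g _; rewrite {1}(mpolywE (sz g)) raddf_sum mulr_suml; apply: eq_bigr => m _.
  by rewrite /= substZ scalerAl.
rewrite pair_big /= (bigID A) /= [X in _ + X]big1 ?addr0; last first.
  move=> [g m] /= /eqP ne; have -> : (b g)@_m = 0; last by rewrite scale0r.
  apply/eqP/negP => /negP bm; have [/homogpP h h'] := hb g.
  have := h _ bm; case: (ltnP M (mdeg (boxm g))) => [lt|le e].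
    by move: bm; rewrite h' // mcoeff0 eqxx.
  by case: ne; rewrite e subnKC.
exact: (big_sub A (fun x => (b x.1)@_(x.2) *: (subst y 'X_[x.2] * 'X_[boxm x.1]))).
Qed.

(** Each pair of a box monomial and a monomial in [y] has a single total degree, so the sum over
    degrees counts it at most once, and monomials of exact degree need not be counted. *)
Lemma fin_over_sum_hilbert K :
  (\sum_(M < K.+1) hilbert_fun J M <= E ^ n * K.+1 ^ s)%N.
Proof.
have cX : (#|{: 'X_{1..s < K.+1}}| <= K.+1 ^ s)%N.
  have lt (m : 'X_{1..s < K.+1}) i : ((m : 'X_{1..s}) i < K.+1)%N.
    by apply: leq_ltn_trans (bmdeg m); rewrite mdegE (bigD1 i) //= leq_addr.
  pose f (m : 'X_{1..s < K.+1}) : {ffun 'I_s -> 'I_K.+1} := [ffun i => Ordinal (lt m i)].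
  have fI : injective f.
    move=> m m' /ffunP e; apply/val_inj/mnmP => i.
    by have := congr1 val (e i); rewrite !ffunE.
  by have := leq_card f fI; rewrite card_ffun !card_ord.
have cT : (#|{: {ffun 'I_n -> 'I_E} * 'X_{1..s < K.+1}}| <= E ^ n * K.+1 ^ s)%N.
  by rewrite card_prod card_ffun !card_ord leq_mul2l cX orbT.
apply: leq_trans cT.
apply: (@leq_trans (\sum_(M < K.+1) #|[pred x : {ffun 'I_n -> 'I_E} * 'X_{1..s < K.+1} |
                         mdeg (boxm x.1) + mdeg x.2 == M]|)%N).
  by apply: leq_sum => M _; apply: fin_over_hilbert; rewrite -ltnS.
under eq_bigr => M _ do rewrite -sum1_card.
rewrite (exchange_big_dep predT) //= -sum1_card; apply: leq_sum => x _.
case: (ltnP (mdeg (boxm x.1) + mdeg x.2) K.+1) => [lt|le].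
  by rewrite (big_pred1 (Ordinal lt)) // => i; rewrite /= eq_sym.
rewrite big_pred0 // => i; apply/negbTE/eqP => e; move: le; rewrite e.
by rewrite leqNgt ltn_ord.
Qed.

End Finite.

Lemma expn_le_bin M r : (M.+1 ^ r <= r`! * 'C(M + r, r))%N.
Proof.
rewrite mulnC bin_ffact; elim: r => [|r IH]; first by rewrite ffactn0.
by rewrite addnS ffactSS expnS leq_mul // ltnS leq_addr.
Qed.

(** If [s <= r], the sums of the Hilbert function up to [e * M] would grow at least like M^(r+1) but
    at most like M^s. *)
Lemma fin_over_grows_lt J s (y : 'I_s -> {mpoly F[n]}) r :
  homogeneous_ideal J -> lin_forms y -> fin_over J y -> grows r J -> (r < s)%N.
Proof.
move=> hJ hy [E finE] [e [e0 gr]]; rewrite ltnNge; apply/negP => le_sr.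
pose S K := (\sum_(M < K.+1) hilbert_fun J M)%N.
have S_ge M : ('C(M + r.+1, r.+1) <= S (e * M))%N.
  elim: M => [|M IH].
    rewrite muln0 add0n binn /S big_ord1; have := gr 0%N.
    by rewrite muln0 add0n binn.
  rewrite addSn binS addnC.
  apply: (@leq_trans (hilbert_fun J (e * M.+1) + S (e * M))%N).
    by apply: leq_add => //; have := gr M.+1; rewrite addSnnS.
  rewrite /S [leqRHS]big_ord_recr /= addnC leq_add2r.
  rewrite (big_ord_widen (e * M.+1) (fun M => hilbert_fun J M)); last first.
    by rewrite mulnS -addn1 addnC leq_add2r.
  by rewrite big_mkcond; apply: leq_sum => i _; case: ifP.
(* The two bounds on [S (e * M)] give [M.+1 <= c] for every [M], which is absurd for [M := c]. *)
pose c := (r.+1`! * (E ^ n * e ^ s))%N.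
have le M : (M.+1 ^ s * M.+1 <= M.+1 ^ s * c)%N.
  rewrite -expnSr; apply: (@leq_trans (M.+1 ^ r.+1)); first by apply: leq_pexp2l.
  apply: leq_trans (expn_le_bin _ _) _; rewrite /c mulnCA leq_mul2l; apply/orP; right.
  apply: leq_trans (S_ge M) _; apply: leq_trans (fin_over_sum_hilbert hJ hy finE _) _.
  rewrite mulnCA leq_mul2l -expnMn [(M.+1 * e)%N]mulnC; apply/orP; right.
  have le : ((e * M).+1 <= e * M.+1)%N by rewrite mulnS; lia.
  by case: (posnP s) => [->|s0]; rewrite ?expn0 // leq_exp2r.
have := le c; rewrite leq_mul2l expn_eq0 /= ltnn; lia.
Qed.

End Growth.

(** * Noether normalization *)

Definition infinite_field (F : fieldType) : Prop :=
  forall p : {poly F}, p != 0 -> exists x, p.[x] != 0.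

Lemma closed_field_infinite (K : closedFieldType) : infinite_field K.
Proof.
move=> p p0; apply: NNPP => h.
have z x : p.[x] = 0 by apply/eqP; apply: contra_notT h => nz; exists x.
have [s1|s1] := leqP (size p) 1.
  have e := size1_polyC s1; case/eqP: p0; rewrite e.
  by have := z 0; rewrite {1}e hornerC => ->.
have : size (p + 1) != 1%N by rewrite size_polyDl ?size_poly1 // neq_ltn s1 orbT.
case/closed_rootP => x; rewrite rootE hornerD z hornerC add0r.
by rewrite oner_eq0.
Qed.

Lemma digits_inj B s (a b : 'I_s -> nat) :
  (forall i, a i < B)%N -> (forall i, b i < B)%N ->
  (\sum_i a i * B ^ i = \sum_i b i * B ^ i)%N -> a =1 b.
Proof.
elim: s a b => [|s IH] a b ha hb; first by move=> _ [].
have shift (c : 'I_s.+1 -> nat) :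
    (\sum_i c i * B ^ i = (\sum_(i < s) c (lift ord0 i) * B ^ i) * B + c ord0)%N.
  rewrite big_ord_recl expn0 muln1 addnC; congr (_ + _)%N.
  by rewrite big_distrl; apply: eq_bigr => i _; rewrite /= /bump /= add1n expnSr mulnA.
rewrite !shift => e.
have e0 : a ord0 = b ord0.
  by have := congr1 (modn^~ B) e; rewrite !modnMDl !modn_small.
have B0 : (0 < B)%N by apply: leq_ltn_trans (ha ord0).
have : (\sum_(i < s) a (lift ord0 i) * B ^ i = \sum_(i < s) b (lift ord0 i) * B ^ i)%N.
  by apply/eqP; rewrite -(eqn_pmul2r B0); apply/eqP/(@addIn (a ord0)); rewrite {2}e0.
move/IH => h i; case: (unliftP ord0 i) => [j|] -> //; exact: h.
Qed.

(** Kronecker substitution: with [B] above all exponents, sending the i-th variable to the power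
    [B ^ i] of a single one keeps distinct monomials distinct, by uniqueness of digits in base
    [B]. *)
Lemma meval_nonzero (F : fieldType) s (q : {mpoly F[s]}) : infinite_field F ->
  q != 0 -> exists v, q.@[v] != 0.
Proof.
move=> infF q0; pose B := msize q; pose w (m : 'X_{1..s}) := (\sum_i m i * B ^ i)%N.
pose P : {poly F} := \sum_(m <- msupp q) q@_m *: 'X^(w m).
have : P != 0.
  have q0s := mlead_supp q0.
  apply: contraTneq q0s => /(congr1 (fun p : {poly F} => p`_(w (mlead q)))).
  rewrite coef0 coef_sum (bigD1_seq (mlead q)) ?msupp_uniq ?mlead_supp //=.
  rewrite coefZ coefXn eqxx mulr1 big_seq_cond big1 => [|m /andP[mq ne]].
    by rewrite addr0 => /eqP; rewrite mleadc_eq0 (negbTE q0).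
  rewrite coefZ coefXn; case: eqP => [e|_]; last by rewrite mulr0.
  case/eqP: ne; apply/mnmP; apply: (digits_inj (B := B)) (esym e) => i.
    by apply: leq_ltn_trans (msize_mdeg_lt mq); rewrite mdegE (bigD1 i) //= leq_addr.
  apply: leq_ltn_trans (msize_mdeg_lt (mlead_supp q0)).
  by rewrite mdegE (bigD1 i) //= leq_addr.
case/infF => x Px; exists (fun i => x ^+ (B ^ i)); apply: contraNneq Px => e.
apply/eqP; rewrite -[RHS]e mevalE /P horner_sum; apply: eq_bigr => m _.
rewrite hornerZ hornerXn /w -prodrXr; congr (_ * _); apply: eq_bigr => i _.
by rewrite -exprM mulnC.
Qed.

Section Homog.
Variables (F : fieldType) (s : nat).
Implicit Types (q : {mpoly F[s]}).

Lemma meval_scale D q a v : homogp D q -> q.@[fun i => a * v i] = a ^+ D * q.@[v].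
Proof.
move=> /homogpP hq; rewrite !mevalE mulr_sumr big_seq [RHS]big_seq.
apply: eq_bigr => m; rewrite mcoeff_msupp => /hq <-.
rewrite mulrCA; congr (_ * _); under eq_bigr => i _ do rewrite exprMn.
by rewrite big_split /= prodrXr mdegE.
Qed.

Lemma subst_scale n D q (c : 'I_s -> F) (z : {mpoly F[n]}) : homogp D q ->
  subst (fun i => c i *: z) q = q.@[c] *: z ^+ D.
Proof.
move=> /homogpP hq; rewrite substE mevalE scaler_suml big_seq [RHS]big_seq.
apply: eq_bigr => m; rewrite mcoeff_msupp => /hq <-.
under eq_bigr => i _ do rewrite exprZn.
by rewrite scaler_prod prodrXr -mdegE scalerA.
Qed.

Lemma subst_congr n (A : {mpoly F[n]} -> Prop) (y z : 'I_s -> {mpoly F[n]}) q :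
  is_ideal A -> (forall i, A (y i - z i)) -> A (subst y q - subst z q).
Proof.
move=> idA h; rewrite !substE; apply: (idB_sum idA) => m _.
rewrite -scalerBr; apply: (idZ idA).
elim/big_rec2: _ => [|i f g _ hfg]; first by rewrite subrr; apply: id0.
by apply: (idB_mul idA) => //; apply: (idB_exp).
Qed.

End Homog.

(** The factor ['X_ord0] makes the first coordinate of the point nonzero, and homogeneity allows
    rescaling it to 1. *)
Lemma homog_nonzero_at1 (F : fieldType) s D (q : {mpoly F[s.+1]}) : infinite_field F ->
  homogp D q -> q != 0 -> exists v, v ord0 = 1 /\ q.@[v] != 0.
Proof.
move=> infF hq q0; have : q * 'X_ord0 != 0.
  by rewrite mulf_eq0 negb_or q0 /= -msize_poly_eq0 msizeX.
case/(meval_nonzero infF) => v; rewrite mevalM mevalXU mulf_eq0 negb_or => /andP[qv v0].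
exists (fun i => (v ord0)^-1 * v i); split; first by rewrite mulVf.
by rewrite (meval_scale _ _ hq) mulf_neq0 // expf_neq0 // invr_eq0.
Qed.

Section Noether.
Variables (F : fieldType) (n : nat).
Hypothesis infF : infinite_field F.
Implicit Types (J : {mpoly F[n]} -> Prop).

Definition shear s (lam : 'I_s -> F) (y : 'I_s.+1 -> {mpoly F[n]}) (i : 'I_s) : {mpoly F[n]} :=
  y (lift ord0 i) - lam i *: y ord0.

Lemma shear_lin_forms s (lam : 'I_s -> F) y : lin_forms y -> lin_forms (shear lam y).
Proof. by move=> hy i; rewrite /shear -scaleNr; apply: homogpD => //; apply: homogpZ. Qed.

(* Modulo the sheared forms each [y i] is a multiple of [y ord0], so that [q] evaluated at [y]
   becomes a multiple of a power of [y ord0]; the multiplier is a nonzero value of [q]. *)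
Lemma sheared_fin_over s D (q : {mpoly F[s.+1]}) : homogp D q -> q != 0 ->
  exists lam : 'I_s -> F, forall J (y : 'I_s.+1 -> {mpoly F[n]}) t,
    is_ideal J -> fin_over J y -> sumI J (shear lam y) (subst y q ^+ t) ->
    fin_over J (shear lam y).
Proof.
move=> hq q0; have [v [v0 qv]] := homog_nonzero_at1 infF hq q0.
exists (fun i => v (lift ord0 i)) => J y t idJ [E finE].
set y' := shear _ y; pose A := sumI J y'; have idA : is_ideal A by apply: sumI_ideal.
move=> Aq; have yA i : A (y i - v i *: y ord0).
  case: (unliftP ord0 i) => [j|] ->; first exact: (sumI_gen idJ y' j).
  by rewrite v0 scale1r subrr; apply: id0.
have Ay : A (y ord0 ^+ (D * t)).
  have h := idB_exp idA t (subst_congr q idA yA).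
  have := idB_mem idA (idB_sym idA h) Aq.
  rewrite (subst_scale _ _ hq) exprZn -exprM => /(idZ idA (q.@[v] ^+ t)^-1).
  by rewrite scalerA mulVf ?scale1r // expf_neq0.
exists (E * (D * t))%N => i; have Xi : sumI1 A (y ord0) ('X_i ^+ E).
  apply: (sumI_min (J := J) (y := y)) (finE i).
  - exact: sumI_ideal.
  - by move=> f Jf; do 2![apply: sumI_sub => //].
  move=> j; apply/sumI1P; exists (v j)%:MP; rewrite mul_mpolyC; exact: yA.
case/sumI1P: Xi => // a ha; rewrite exprM; apply: (idB_mem idA (idB_exp idA _ ha)).
by rewrite exprMn; apply: idMl.
Qed.

Lemma dependent_homog J s (y : 'I_s -> {mpoly F[n]}) : homogeneous_ideal J -> lin_forms y ->
  ~ indep_over J y -> exists D q, [/\ homogp D q, q != 0 & J (subst y q)].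
Proof.
move=> hJ hy /not_forall_exists [q nq]; have [Jq /eqP q0] := imply_to_and _ _ nq.
have [D qD] : exists D, hcomp D q != 0.
  apply: NNPP => h; case/eqP: q0; rewrite (hcomp_sumE (leqnn (msize q))) big1 // => i _.
  by apply/eqP/negP => /negP h'; apply: h; exists i.
exists D, (hcomp D q); split=> //; first exact: hcomp_homog.
by rewrite -hcomp_subst //; apply: hid_hcomp.
Qed.

Lemma indep_over0 J (y : 'I_0 -> {mpoly F[n]}) : is_ideal J -> ~ J 1 -> indep_over J y.
Proof.
move=> idJ J1 q; rewrite (nvar0_mpolyC q) substC => Jq; apply: NNPP => /eqP.
rewrite mpolyC_eq0 => c0; apply: J1; have := idMl idJ (q@_0%MM)^-1%:MP Jq.
by rewrite -mpolyCM mulVf // mpolyC1.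
Qed.

Lemma dependent_fin_over J s (y : 'I_s.+1 -> {mpoly F[n]}) :
  homogeneous_ideal J -> lin_forms y -> fin_over J y -> ~ indep_over J y ->
  exists y' : 'I_s -> {mpoly F[n]}, lin_forms y' /\ fin_over J y'.
Proof.
move=> hJ hy fy /(dependent_homog hJ hy) [D [q [hq q0 Jq]]].
have [lam hlam] := sheared_fin_over hq q0; exists (shear lam y); split.
  exact: shear_lin_forms.
by apply: (hlam J y 1%N) => //; [exact: hid_ideal | apply: sumI_sub; rewrite ?expr1 //; apply: hid_ideal].
Qed.

(** Starting from all the variables, each dependence costs one form; the empty family is independent
    because 1 is not in [J]. *)
Lemma noether_normalization J : homogeneous_ideal J -> ~ J 1 ->
  exists s (y : 'I_s -> {mpoly F[n]}), [/\ lin_forms y, fin_over J y & indep_over J y].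
Proof.
move=> hJ J1; have idJ := hid_ideal hJ.
suff h s (y : 'I_s -> {mpoly F[n]}) : lin_forms y -> fin_over J y ->
    exists s (y : 'I_s -> {mpoly F[n]}), [/\ lin_forms y, fin_over J y & indep_over J y].
  apply: (h n (fun i => 'X_i)) => [i|]; first exact: homogp_X1.
  by exists 1%N => i; rewrite expr1; apply: (sumI_gen idJ (fun i => 'X_i)).
elim: s y => [|s IH] y hy fy.
  by exists 0%N, y; split=> //; apply: indep_over0.
case: (classic (indep_over J y)) => [iy|]; first by exists s.+1, y.
by case/(dependent_fin_over hJ hy fy) => y' [hy' fy']; apply: IH fy'.
Qed.

End Noether.

(** * Noetherianity and associated primes *)

Definition incr_seq (phi : nat -> nat) : Prop := forall i j, (i < j)%N -> (phi i < phi j)%N.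

(** Each index minimises [v] on the tail after the previous one, so its value is below all later
    ones. *)
Lemma nondecreasing_subseq (v : nat -> nat) :
  exists phi, incr_seq phi /\ forall i j, (i <= j)%N -> (v (phi i) <= v (phi j))%N.
Proof.
have ex N : {k | (N <= k)%N /\ forall l, (N <= l)%N -> (v k <= v l)%N}.
  apply: constructive_indefinite_description.
  have [w [[k [Nk <-]] min]] :=
    @least_nat (fun w => exists k, (N <= k)%N /\ v k = w) (v N) (ex_intro _ N (conj (leqnn N) erefl)).
  exists k; split=> // l Nl; rewrite leqNgt; apply/negP => /min; apply; by exists l.
pose phi := fix phi i := if i is i'.+1 then sval (ex (phi i').+1) else sval (ex 0%N).
have phiS i : (phi i < phi i.+1)%N by case: (svalP (ex (phi i).+1)).
have phi_min i l : (phi i <= l)%N -> (v (phi i) <= v l)%N.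
  case: i => [|i] /= le; first by case: (svalP (ex 0%N)) => _; apply.
  case: (svalP (ex (phi i).+1)) => le' h; apply: h; exact: leq_trans le.
have phi_incr : incr_seq phi by move=> i j; exact: (homo_ltn ltn_trans phiS).
exists phi; split=> // i j; rewrite leq_eqVlt => /orP[/eqP -> //|lt].
by apply/phi_min/ltnW/phi_incr.
Qed.

(** One extraction per coordinate makes all coordinates nondecreasing along a common subsequence,
    whose first two terms are then comparable. *)
Lemma dickson n (u : nat -> 'X_{1..n}) : exists i j, (i < j)%N /\ (u i <= u j)%MM.
Proof.
suff [phi [phi_incr h]] : exists phi, incr_seq phi /\
    forall c, c \in enum 'I_n -> forall i j, (i <= j)%N -> (u (phi i) c <= u (phi j) c)%N.
  exists (phi 0%N), (phi 1%N); split; first exact: phi_incr.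
  by apply/mnm_lepP => c; apply: h; rewrite ?mem_enum.
elim: (enum 'I_n) => [|c cs [phi [phi_incr h]]]; first by exists id; split=> // i j.
have [psi [psi_incr h']] := nondecreasing_subseq (fun i => u (phi i) c).
exists (phi \o psi); split=> [i j /psi_incr/phi_incr|] // c'.
rewrite inE => /orP[/eqP ->|/h hc'] i j le; first exact: h'.
apply: hc'; move: le; rewrite leq_eqVlt => /orP[/eqP -> //|lt]; exact/ltnW/psi_incr.
Qed.

Section Noetherian.
Variables (F : fieldType) (n : nat).
Implicit Types (I J : {mpoly F[n]} -> Prop) (f g : {mpoly F[n]}).

Lemma minimal_mlead (P : {mpoly F[n]} -> Prop) f : P f ->
  exists g, P g /\ forall h, P h -> ~~ (mlead h < mlead g)%O.
Proof.
move=> Pf; apply: NNPP => nex; suff: forall m, forall g, P g -> mlead g = m -> False.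
  by move/(_ (mlead f) f Pf); apply.
apply: ltmwf => m IH g Pg gm; apply: nex; exists g; split=> // h Ph; apply/negP.
by rewrite gm => lt; apply: IH lt h Ph erefl.
Qed.

(** Without a maximal member there is a strictly increasing chain [X], and [f i] has the smallest
    leading monomial in [X i.+1] outside [X i]. By Dickson's lemma some [mlead (f i)] divides a
    later [mlead (f j)]; cancelling the leading term of [f j] with a multiple of [f i] contradicts
    the choice of [f j]. *)
Lemma noetherian (Phi : ({mpoly F[n]} -> Prop) -> Prop) I0 :
  (forall I, Phi I -> is_ideal I) -> Phi I0 ->
  exists I, Phi I /\ forall J, Phi J -> (forall f, I f -> J f) -> forall f, J f -> I f.
Proof.
move=> idPhi Phi0; apply: NNPP => nex.
have step (X : {I | Phi I}) : {Y : {I | Phi I} * {mpoly F[n]} |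
    [/\ forall f, sval X f -> sval Y.1 f, sval Y.1 Y.2, ~ sval X Y.2 &
        forall g, sval Y.1 g -> ~ sval X g -> ~~ (mlead g < mlead Y.2)%O]}.
  apply: constructive_indefinite_description; case: X => I PhiI /=.
  apply: NNPP => nex'; apply: nex; exists I; split=> // J PhiJ sub f Jf.
  apply: NNPP => If.
  have [g [[Jg Ig] min]] := minimal_mlead (conj Jf If : (fun f => J f /\ ~ I f) f).
  by apply: nex'; exists (exist _ J PhiJ, g); split=> //= h Jh Ih; apply: min.
pose X := fix X i : {I | Phi I} :=
  if i is i'.+1 then (sval (step (X i'))).1 else exist _ I0 Phi0.
pose f i := (sval (step (X i))).2.
have idX i : is_ideal (sval (X i)) by apply: idPhi; exact: (svalP (X i)).
have XS i g : sval (X i) g -> sval (X i.+1) g by case: (svalP (step (X i))) => h _ _ _; apply: h.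
have Xle i j g : (i <= j)%N -> sval (X i) g -> sval (X j) g.
  by move=> /subnK <-; elim: (j - i)%N => // k IH h; rewrite addSn; apply/XS/IH.
have fS i : sval (X i.+1) (f i) by case: (svalP (step (X i))).
have fN i : ~ sval (X i) (f i) by case: (svalP (step (X i))).
have fmin i g : sval (X i.+1) g -> ~ sval (X i) g -> ~~ (mlead g < mlead (f i))%O.
  by case: (svalP (step (X i))) => _ _ _; apply.
have f0 i : f i != 0 by apply/eqP => e; apply: (fN i); rewrite e; apply: id0.
have [i [j [lt_ij le]]] := dickson (fun i => mlead (f i)).
pose h := (mleadc (f j) / mleadc (f i)) *: ('X_[mlead (f j) - mlead (f i)] * f i).
have Xh : sval (X j) h by apply: idZ => //; apply: idMl => //; apply: Xle lt_ij _.
have lch : h@_(mlead (f j)) = mleadc (f j).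
  have := mcoeffMX (f i) (mlead (f j) - mlead (f i))%MM (mlead (f i)).
  by rewrite submK // mcoeffZ mulrC => ->; rewrite divfK // mleadc_eq0.
have lh : (mlead h <= mlead (f j))%O.
  apply: le_trans (mleadZ_le _ _) _; apply: le_trans (mleadM_le _ _) _.
  by rewrite mleadXm submK.
have Xg : sval (X j.+1) (f j - h) by apply: idB => //; apply: XS.
have Ng : ~ sval (X j) (f j - h).
  by move=> Xg'; apply: (fN j); rewrite -(subrK h (f j)); apply: idD.
have g0 : f j - h != 0 by apply/eqP => e; apply: Ng; rewrite e; apply: id0.
have := fmin _ _ Xg Ng; rewrite lt_neqAle negb_and negbK => /orP[/eqP e|].
  by move: g0; rewrite -mleadc_eq0 e mcoeffB lch subrr eqxx.
by rewrite (le_trans (mleadB_le _ _)) // leUx lexx.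
Qed.

Definition hprime I : Prop :=
  ~ I 1 /\ forall d e a b, homogp d a -> homogp e b -> I (a * b) -> I a \/ I b.

(** Gauss's argument: at the first [a i] and the first [b j] outside [I], the convolution of index
    [i + j] is [a i * b j] modulo [I]. It serves both for homogeneous components and for
    coefficients of powers of t. *)
Lemma conv_prime I (a b : nat -> {mpoly F[n]}) : is_ideal I ->
  (forall i j, I (a i * b j) -> I (a i) \/ I (b j)) ->
  (forall l, I (\sum_(i < l.+1) a i * b (l - i)%N)) ->
  (forall i, I (a i)) \/ (forall j, I (b j)).
Proof.
move=> idI pr h; apply: NNPP => /not_or_and [/not_forall_exists [i0 ai0] /not_forall_exists [j0 bj0]].
have [i [ai mini]] := @least_nat (fun i => ~ I (a i)) _ ai0; have [j [bj minj]] := @least_nat (fun i => ~ I (b i)) _ bj0.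
have lt : (i < (i + j).+1)%N by rewrite ltnS leq_addr.
have := h (i + j)%N; rewrite (bigD1 (Ordinal lt)) //= addKn => hs.
have : I (a i * b j).
  rewrite -[X in I X](addrK (\sum_(k < (i + j).+1 | k != Ordinal lt) a k * b (i + j - k)%N)).
  apply: (idB idI) => //; apply: (id_sum idI) => k ne.
  case: (ltngtP k i) => [lt'|gt|e].
  - by apply: (idMr idI); apply: NNPP; apply: mini.
  - apply: (idMl idI); apply: NNPP; apply: minj; have := ltn_ord k; lia.
  - by case/eqP: ne; apply: val_inj.
by case/pr.
Qed.

Lemma hprime_prime I : homogeneous_ideal I -> hprime I -> prime_ideal I.
Proof.
move=> hI [I1 pr]; split=> //; first exact: hid_ideal.
move=> f g Ifg; case: (@conv_prime I (hcomp^~ f) (hcomp^~ g)).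
- exact: hid_ideal.
- by move=> i j; apply: (pr i j); apply: hcomp_homog.
- by move=> l; rewrite -hcompM; apply: hid_hcomp.
- by left; apply: (hid_comps hI).
- by right; apply: (hid_comps hI).
Qed.

(** Maximality among homogeneous ideals missing [S] makes [Q] prime: adjoining either of two forms
    outside [Q] reaches [S], hence so would adjoining their product. The last clause keeps the
    maximality for the Nullstellensatz. *)
Lemma hprime_avoiding I (S : {mpoly F[n]} -> Prop) : homogeneous_ideal I ->
  S 1 -> (forall f g, S f -> S g -> S (f * g)) -> (forall f, S f -> ~ I f) ->
  exists Q, [/\ homogeneous_ideal Q, hprime Q, forall f, I f -> Q f,
    forall f, S f -> ~ Q f &
    forall d a, homogp d a -> ~ Q a -> exists f, S f /\ sumI1 Q a f].
Proof.
move=> hI S1 SM SI.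
pose Phi Q := [/\ homogeneous_ideal Q, forall f, I f -> Q f & forall f, S f -> ~ Q f].
have [] := @noetherian Phi I; first by move=> Q [[]].
  by split.
move=> Q [[hQ subQ SQ] maxQ]; have idQ := hid_ideal hQ.
have meet d a : homogp d a -> ~ Q a -> exists f, S f /\ sumI1 Q a f.
  move=> ha Qa; apply: NNPP => nex; apply: Qa.
  apply: (maxQ (sumI1 Q a)).
  - split; first by apply: (sumI_homog (e := fun=> d)).
      by move=> f /subQ; apply: sumI_sub.
    by move=> f Sf Qf; apply: nex; exists f.
  - by move=> f; apply: sumI_sub.
  - exact: (sumI_gen idQ (fun=> a) ord0).
exists Q; split=> //; split; first exact: SQ.
move=> d e a b ha hb Qab; apply: NNPP => /not_or_and [Qa Qb].
have [f [Sf /sumI1P [x hx]]] := meet _ _ ha Qa.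
have [g [Sg /sumI1P [y hy]]] := meet _ _ hb Qb.
apply: (SQ (f * g)); first exact: SM.
apply: (idB_mem idQ (idB_mul idQ hx hy)); rewrite mulrACA; exact: idMl.
Qed.

Lemma colon_ideal I g : is_ideal I -> is_ideal (fun f => I (f * g)).
Proof.
move=> idI; split=> [|f h If Ih|f h If]; first by rewrite mul0r; apply: id0.
  by rewrite mulrDl; apply: idD.
by rewrite -mulrA; apply: idMl.
Qed.

Lemma colon_homog I d g : homogeneous_ideal I -> homogp d g ->
  homogeneous_ideal (fun f => I (f * g)).
Proof.
move=> hI hg; split; first exact/colon_ideal/hid_ideal.
move=> f e /(hid_hcomp hI (e + d)); rewrite (hcompM_homogr _ _ hg) leq_addl addnK.
by [].
Qed.

(** [P] is maximal among the colon ideals of forms that lie inside [C]. If it contains [a * b] but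
    neither factor, the colon ideal of [a * g] strictly contains it and so has a form outside [C],
    say f. The colon ideal of f g lies in [C], since [C] is prime, and contains [a], against
    maximality. *)
Lemma associated_prime_below I C : homogeneous_ideal I -> homogeneous_ideal C -> hprime C ->
  (forall f, I f -> C f) ->
  exists P, [/\ associated_prime I P, homogeneous_ideal P, forall f, I f -> P f
    & forall f, P f -> C f].
Proof.
move=> hI hC [C1 prC] subC; have idI := hid_ideal hI; have idC := hid_ideal hC.
pose Phi P := exists d g, [/\ homogp d g, P = (fun f => I (f * g)) & forall f, P f -> C f].
have [] := @noetherian Phi I.
- by move=> P [d [g [_ -> _]]]; apply: colon_ideal.
- exists 0%N, 1; split=> //; first exact: homogp1.
  by apply: functional_extensionality_dep => f; rewrite mulr1.
move=> P [[d [g [hg eP PC]]] maxP].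
have hP : homogeneous_ideal P by rewrite eP; apply: (colon_homog hI hg).
have hprP : hprime P.
  split; first by move=> P1; apply: C1; apply: PC.
  move=> e e' a b ha hb Pab; apply: NNPP => /not_or_and [Pa Pb]; apply: Pb.
  have hag : homogp (e + d) (a * g) by apply: homogpM.
  apply: (maxP (fun f => I (f * (a * g)))); first 1 last.
  - move=> f; rewrite eP mulrCA; exact: idMl.
  - by move: Pab; rewrite eP -mulrA mulrCA.
  exists (e + d)%N, (a * g); split=> // f If; apply: NNPP => nCf.
  have [k Cfk] := hid_notin hC nCf.
  have Ifk : I (hcomp k f * (a * g)) by have [_ h] := colon_homog hI hag; apply: h.
  apply: Pa; apply: (maxP (fun x => I (x * (hcomp k f * g)))); first 1 last.
  - by move=> x; rewrite eP mulrCA; exact: idMl.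
  - by rewrite mulrCA.
  have hfg : homogp (k + d) (hcomp k f * g) by apply: homogpM => //; apply: hcomp_homog.
  exists (k + d)%N, (hcomp k f * g); split=> // x Ix.
  apply: (hid_comps hC) => l.
  have : C (hcomp l x * hcomp k f).
    apply: PC; rewrite eP -mulrA; have [_ h] := colon_homog hI hfg; exact: h.
  by case/(prC l k); rewrite ?hcomp_homog //.
exists P; split=> //; last by move=> f If; rewrite eP; apply: idMr.
split; first exact: hprime_prime.
by exists g => f; rewrite eP.
Qed.

End Noetherian.

(** * Base change *)

Section LinearForms.
Variables (R : comNzRingType) (n : nat).
Implicit Types (w : 'X_{1..n} -> R) (f g : {mpoly R[n]}).

Definition lform w f : R := \sum_(m <- msupp f) f@_m * w m.

Lemma lformwE w f k : (msize f <= k)%N ->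
  lform w f = \sum_(m : 'X_{1..n < k}) f@_m * w m.
Proof.
move=> le; set I : subFinType _ := 'X_{1..n < k}.
rewrite /lform (big_mksub I) ?msupp_uniq //=; first last.
  by move=> x /msize_mdeg_lt /leq_trans; apply.
by rewrite big_rmcond //= => j /memN_msupp_eq0 ->; rewrite mul0r.
Qed.

Lemma lform_linear w c f g : lform w (c *: f + g) = c * lform w f + lform w g.
Proof.
pose k := maxn (msize (c *: f + g)) (maxn (msize f) (msize g)).
rewrite !(@lformwE w _ k) ?leq_max ?leqnn ?orbT // mulr_sumr -big_split.
by apply: eq_bigr => m _; rewrite mcoeffD mcoeffZ mulrDl mulrA.
Qed.

Lemma lform0 w : lform w 0 = 0.
Proof. by rewrite /lform msupp0 big_nil. Qed.

Lemma lformD w f g : lform w (f + g) = lform w f + lform w g.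
Proof. by rewrite -[f]scale1r lform_linear mul1r scale1r. Qed.

Lemma lformZ w c f : lform w (c *: f) = c * lform w f.
Proof. by rewrite -[c *: f]addr0 lform_linear lform0 addr0. Qed.

Lemma lform_sum w (T : Type) (r : seq T) (P : pred T) (f : T -> {mpoly R[n]}) :
  lform w (\sum_(i <- r | P i) f i) = \sum_(i <- r | P i) lform w (f i).
Proof. by apply: (big_morph _ (lformD w) (lform0 w)). Qed.

Lemma lformX w m : lform w 'X_[m] = w m.
Proof. by rewrite /lform msuppX big_seq1 mcoeffX eqxx mul1r. Qed.

Lemma lformXM w a f : lform w ('X_[a] * f) = lform (fun m => w (a + m)%MM) f.
Proof.
rewrite {1}[f]mpolyE mulr_sumr lform_sum; apply: eq_bigr => m _.
by rewrite -scalerAr lformZ -mpolyXD lformX.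
Qed.

Lemma lform_hcomp w d f :
  lform w (hcomp d f) = lform (fun m => if mdeg m == d then w m else 0) f.
Proof.
rewrite /hcomp lform_sum big_mkcond; apply: eq_bigr => m _.
by rewrite lformZ lformX; case: ifP; rewrite ?mulr0.
Qed.

End LinearForms.

Lemma lform_map (R S : comNzRingType) (phi : {rmorphism R -> S}) n w (f : {mpoly R[n]}) :
  lform (phi \o w) (map_mpoly phi f) = phi (lform w f).
Proof.
rewrite [in LHS](mpolyE f) raddf_sum lform_sum raddf_sum; apply: eq_bigr => m _.
by rewrite /= map_mpolyZ map_mpolyX lformZ lformX rmorphM.
Qed.

Lemma map_mpoly_homog (R S : comNzRingType) (phi : {rmorphism R -> S}) n d (f : {mpoly R[n]}) :
  homogp d f -> homogp d (map_mpoly phi f).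
Proof.
move=> /homogpP h; apply/homogpP => m; rewrite mcoeff_map_mpoly => fm; apply: h.
by apply: contra_neq fm => ->; exact: rmorph0.
Qed.

Section Dual.
Variables (k : fieldType) (n : nat) (I : {mpoly k[n]} -> Prop).
Hypothesis hI : homogeneous_ideal I.
Let idI := hid_ideal hI.

(** [w i] sends a monomial of degree [M] to its i-th coordinate modulo [I] in the basis [p], and
    other monomials to 0. Being linear forms on all of k[x] that kill [I], the [w i] can be used to
    test membership in [base_change]. *)
Lemma dual_basis M : exists (p : 'I_(hilbert_fun I M) -> {mpoly k[n]})
  (w : 'I_(hilbert_fun I M) -> 'X_{1..n} -> k),
  [/\ indep_fam I M p, forall i g, I g -> lform (w i) g = 0,
      forall i j, lform (w i) (p j) = (i == j)%:R &
      forall f, I (hcomp M f - \sum_i lform (w i) f *: p i)].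
Proof.
have [p [ip sp]] := basis_hilbert idI M.
have cm m : {c : 'I_(hilbert_fun I M) -> k | mdeg m = M -> I ('X_[m] - \sum_i c i *: p i)}.
  apply: constructive_indefinite_description.
  case: (eqVneq (mdeg m) M) => [e|ne]; last by exists (fun=> 0) => e; case/eqP: ne.
  by have [|c hc] := sp 'X_[m]; [rewrite -e; apply: homogpX | exists c].
pose w i m := if mdeg m == M then sval (cm m) i else 0.
have red f : I (hcomp M f - \sum_i lform (w i) f *: p i).
  have -> : \sum_i lform (w i) f *: p i =
      \sum_(m <- msupp f | mdeg m == M) f@_m *: \sum_i sval (cm m) i *: p i.
    under eq_bigr => i _ do rewrite /lform scaler_suml.
    rewrite exchange_big [RHS]big_mkcond; apply: eq_bigr => m _; case: ifP => md.
      by rewrite scaler_sumr; apply: eq_bigr => i _; rewrite /w md scalerA.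
    by apply: big1 => i _; rewrite /w md mulr0 scale0r.
  rewrite /hcomp; apply: (idB_sum idI) => m /eqP md.
  rewrite -scalerBr; apply: (idZ idI); exact: (svalP (cm m) md).
exists p, w; split=> // [i g Ig|i j].
  have [_ indp] := ip; apply: (indp (fun i => lform (w i) g)).
  exact: (idB_mem idI (idB_sym idI (red g)) (hid_hcomp hI M Ig)).
have [hp indp] := ip; have := red (p j); rewrite (hcomp_id (hp j)) => h.
apply/eqP; rewrite eq_sym -subr_eq0; apply/eqP.
apply: (indp (fun i => (i == j)%:R - lform (w i) (p j))).
rewrite (eq_bigr (fun i => (i == j)%:R *: p i - lform (w i) (p j) *: p i)); last first.
  by move=> l _; rewrite scalerBl.
rewrite sumrB (bigD1 j) //= eqxx scale1r big1 ?addr0 // => l /negbTE ->.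
by rewrite scale0r.
Qed.

Lemma lform_separates f : ~ I f ->
  exists w, (forall g, I g -> lform w g = 0) /\ lform w f != 0.
Proof.
move=> /(hid_notin hI) [M nf]; have [p [w [_ kill _ red]]] := dual_basis M.
apply: NNPP => h; apply: nf; apply: (idB_mem idI (red f)).
apply: (id_sum idI) => i _; have [->|nz] := eqVneq (lform (w i) f) 0.
  by rewrite scale0r; apply: id0.
by case: h; exists (w i); split=> //; apply: kill.
Qed.

End Dual.

Section BaseChange.
Variables (k K : fieldType) (iota : {rmorphism k -> K}) (n : nat).
Implicit Types (I : {mpoly k[n]} -> Prop).

(* The extension of [I] to [K[x]], described as the annihilator of the linear
   forms on [k[x]] that vanish on [I]; a linear form is given by its values [w]
   on monomials. *)
Definition base_change I (f : {mpoly K[n]}) : Prop :=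
  forall w, (forall g, I g -> lform w g = 0) -> lform (iota \o w) f = 0.

Lemma base_change_homog I : homogeneous_ideal I -> homogeneous_ideal (base_change I).
Proof.
move=> hI; have idI := hid_ideal hI; split; last first.
  move=> f d hf w kill; rewrite lform_hcomp.
  have -> : (fun m => if mdeg m == d then (iota \o w) m else 0) =
            iota \o (fun m => if mdeg m == d then w m else 0).
    by apply: functional_extensionality_dep => m /=; case: ifP; rewrite ?rmorph0.
  apply: hf => g Ig; rewrite -lform_hcomp; apply: kill; exact: hid_hcomp.
split=> [w _|f g hf hg w kill|f g hf w kill]; first by rewrite lform0.
  by rewrite lformD hf // hg // addr0.
rewrite [g]mpolyE mulr_suml lform_sum big1 // => a _.
rewrite -scalerAl lformZ lformXM; apply/eqP; rewrite mulf_eq0; apply/orP; right; apply/eqP.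
apply: (hf (fun m => w (a + m)%MM)) => h Ih.
by rewrite -lformXM; apply: kill; apply: idMl.
Qed.

Lemma base_change_map I f : I f -> base_change I (map_mpoly iota f).
Proof. by move=> If w kill; rewrite lform_map kill // rmorph0. Qed.

Lemma base_change_sub I I' : (forall f, I f -> I' f) ->
  forall f, base_change I f -> base_change I' f.
Proof. by move=> sub f h w kill; apply: h => g /sub; apply: kill. Qed.

Lemma hilbert_map_le I (J : {mpoly K[n]} -> Prop) M : homogeneous_ideal I -> is_ideal J ->
  (forall f, I f -> J (map_mpoly iota f)) -> (hilbert_fun J M <= hilbert_fun I M)%N.
Proof.
move=> hI idJ sub; have [p [_ sp]] := basis_hilbert (hid_ideal hI) M.
rewrite -[leqRHS]card_ord; apply: (span_fam_ge idJ (q := fun i => map_mpoly iota (p i))).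
move=> f hf; have cm m : exists c : 'I_(hilbert_fun I M) -> K,
    J (f@_m *: 'X_[m] - \sum_i c i *: map_mpoly iota (p i)).
  have [->|fm] := eqVneq (f@_m) 0.
    exists (fun=> 0); rewrite scale0r big1 ?subr0 => [|i _]; last by rewrite scale0r.
    exact: id0.
  have hm : homogp M ('X_[m] : {mpoly k[n]}).
    by rewrite -((homogpP _ _ hf) _ fm); apply: homogpX.
  have [c /sub] := sp _ hm; rewrite rmorphB /= map_mpolyX => jc.
  exists (fun i => f@_m * iota (c i)); have := idZ idJ (f@_m) jc.
  rewrite scalerBr; congr (J (_ - _)).
  rewrite rmorph_sum scaler_sumr; apply: eq_bigr => i _.
  by rewrite /= map_mpolyZ scalerA.
pose c m := sval (constructive_indefinite_description _ (cm m)).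
exists (fun i => \sum_(m <- msupp f) c m i).
have -> : \sum_i (\sum_(m <- msupp f) c m i) *: map_mpoly iota (p i) =
    \sum_(m <- msupp f) \sum_i c m i *: map_mpoly iota (p i).
  by rewrite exchange_big; apply: eq_bigr => i _; rewrite scaler_suml.
rewrite {1}[f]mpolyE; apply: (idB_sum idJ) => m _.
exact: (svalP (constructive_indefinite_description _ (cm m))).
Qed.

(** A basis over [k] still spans over [K], and its dual forms, extended to [K], still separate
    it. *)
Lemma hilbert_base_change I M : homogeneous_ideal I ->
  hilbert_fun (base_change I) M = hilbert_fun I M.
Proof.
move=> hI; have idE := hid_ideal (base_change_homog hI).
apply/eqP; rewrite eqn_leq; apply/andP; split.
  by apply: hilbert_map_le => // f; apply: base_change_map.
have [p [w [[hp _] kill dual _]]] := dual_basis hI M.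
rewrite -[leqLHS]card_ord; apply: (indep_fam_le idE (p := fun i => map_mpoly iota (p i))).
split=> [i|c Ec i]; first exact: map_mpoly_homog.
have := Ec (w i) (kill i); rewrite lform_sum (bigD1 i) //= lformZ lform_map dual eqxx.
rewrite rmorph1 mulr1 big1 ?addr0 // => j ne.
by rewrite lformZ lform_map dual eq_sym (negbTE ne) rmorph0 mulr0.
Qed.

Lemma base_change_grows I r : homogeneous_ideal I -> grows r I -> grows r (base_change I).
Proof.
move=> hI [e [e0 gr]]; exists e; split=> // M.
by rewrite hilbert_base_change.
Qed.

End BaseChange.

(** * Extension to the field of rational functions *)

Section Fractions.
Local Open Scope quotient_scope.

Lemma fraction_denom (R : idomainType) (x : {fraction R}) :
  exists d c : R, d != 0 /\ tofrac d * x = tofrac c.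
Proof.
elim/quotW: x => r; exists (frac r).2, (frac r).1; split; first exact: denom_ratioP.
rewrite !piE; apply/eqmodP; rewrite /= FracField.equivfE /FracField.mulf.
have d0 := denom_ratioP r.
by rewrite !numden_Ratio ?mul1r ?mulr1 ?oner_neq0 //= ?mulr1 mulrC.
Qed.

End Fractions.

(** The fraction field enters only through injectivity and denominators, which keeps its quotient
    construction out of sight. *)
Lemma ratfun_exists (k : fieldType) : exists (L : fieldType) (tof : {rmorphism {poly k} -> L}),
  injective tof /\ forall x, exists d c, d != 0 /\ tof d * x = tof c.
Proof.
exists {fraction {poly k}}, (@tofrac {poly k}); split; last exact: fraction_denom.
by move=> p q /eqP; rewrite tofrac_eq => /eqP.
Qed.

Section RationalFunctions.
Variables (k L : fieldType) (tof : {rmorphism {poly k} -> L}).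
Hypothesis tof_inj : injective tof.
Hypothesis tof_denom : forall x, exists d c, d != 0 /\ tof d * x = tof c.

Definition ratfun_of : {rmorphism k -> L} := tof \o polyC.

Lemma tof_eq0 c : (tof c == 0) = (c == 0).
Proof. by rewrite -(inj_eq tof_inj) rmorph0. Qed.

Lemma ratfun_infinite : infinite_field L.
Proof.
move=> p p0; apply: NNPP => h.
have z x : root p x by apply/negP => /negP; rewrite rootE => nz; apply: h; exists x.
pose s := [seq tof 'X^i | i <- iota 0 (size p)].
have : (size s < size p)%N.
  apply: max_poly_roots => //; first by apply/allP => x _; apply: z.
  rewrite map_inj_uniq ?iota_uniq // => i j /tof_inj e.
  by have := congr1 (fun q : {poly k} => size q) e; rewrite !size_polyXn => [[]].
by rewrite size_map size_iota ltnn.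
Qed.

Variable n : nat.
Implicit Types (P I : {mpoly k[n]} -> Prop) (A B : {mpoly {poly k}[n]}).

Definition tcoef i A : {mpoly k[n]} := map_mpoly (coefp i) A.

Lemma mcoeff_tcoef i A m : (tcoef i A)@_m = A@_m`_i.
Proof. by rewrite mcoeff_map_mpoly. Qed.

Lemma tcoefM l A B : tcoef l (A * B) = \sum_(i < l.+1) tcoef i A * tcoef (l - i) B.
Proof.
apply/mpolyP => m; rewrite mcoeff_tcoef mcoeffM coef_sum raddf_sum /=.
under [RHS]eq_bigr => i _ do rewrite mcoeffM.
rewrite exchange_big; apply: eq_bigr => j _; rewrite coefM; apply: eq_bigr => i _.
by rewrite !mcoeff_tcoef.
Qed.

Lemma lform_tcoef w i A : lform w (tcoef i A) = (lform (polyC \o w) A)`_i.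
Proof.
pose d := maxn (msize (tcoef i A)) (msize A).
rewrite !(@lformwE _ _ _ _ d) ?leq_max ?leqnn ?orbT // coef_sum; apply: eq_bigr => m _.
by rewrite mcoeff_tcoef coefMC.
Qed.

(** Linear forms over [k] act on the coefficient of each power of t separately. *)
Lemma base_change_tcoef P A : homogeneous_ideal P ->
  base_change ratfun_of P (map_mpoly tof A) <-> forall i, P (tcoef i A).
Proof.
move=> hP; split=> h => [i|w kill].
  apply: NNPP => /(lform_separates hP) [w [kill /eqP]]; apply.
  rewrite lform_tcoef; have := h w kill.
  rewrite (lform_map tof (polyC \o w)) => /eqP; rewrite tof_eq0 => /eqP ->.
  by rewrite coef0.
rewrite (lform_map tof (polyC \o w)); apply/eqP; rewrite tof_eq0.
by apply/eqP/polyP => i; rewrite -lform_tcoef coef0 kill.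
Qed.

Lemma clear_denominators (f : {mpoly L[n]}) :
  exists (c : L) A, c != 0 /\ c *: f = map_mpoly tof A.
Proof.
elim/mpolyind: f => [|a m f _ _ [c [A [c0 e]]]].
  by exists 1, 0; split; rewrite ?oner_neq0 // scaler0 raddf0.
have [d [b [d0 eb]]] := tof_denom a; have [c' [b' [c'0 ec]]] := tof_denom c.
exists (tof d * (tof c' * c)), ((b * b') *: 'X_[m] + (d * c') *: A); split.
  by rewrite !mulf_neq0 // tof_eq0.
rewrite rmorphD /= !map_mpolyZ map_mpolyX -e scalerDr !scalerA !rmorphM /= -ec -eb.
by congr (_ *: _ + _ *: _); rewrite ?mulrA // mulrC !mulrA [a * _]mulrC.
Qed.

Lemma base_change_clear P (c : L) f A : homogeneous_ideal P -> c != 0 ->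
  c *: f = map_mpoly tof A ->
  base_change ratfun_of P f <-> forall i, P (tcoef i A).
Proof.
move=> hP c0 e; rewrite -base_change_tcoef // -e.
have idE := hid_ideal (base_change_homog ratfun_of hP).
split=> [|h]; first exact: (idZ idE).
by rewrite -[f]scale1r -(mulVf c0) -scalerA; apply: (idZ idE).
Qed.

(** After clearing denominators, membership is a condition on coefficients in t, to which the Gauss
    argument [conv_prime] applies. *)
Lemma base_change_prime P : homogeneous_ideal P -> prime_ideal P ->
  prime_ideal (base_change ratfun_of P).
Proof.
move=> hP [idP P1 pr]; split; first exact/hid_ideal/base_change_homog.
  move=> E1; apply: P1.
  have [] := @base_change_clear P 1 1 1 hP; rewrite ?oner_neq0 ?scale1r ?rmorph1 //.
  move=> /(_ E1 0%N) + _; congr (P _); apply/mpolyP => m.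
  by rewrite mcoeff_tcoef !mcoeff1; case: eqP; rewrite ?coef1 ?coef0.
move=> f g; have [c [A [c0 eA]]] := clear_denominators f.
have [d [B [d0 eB]]] := clear_denominators g.
have eAB : (c * d) *: (f * g) = map_mpoly tof (A * B).
  by rewrite rmorphM /= -eA -eB -scalerAl -scalerAr scalerA.
rewrite (base_change_clear hP (mulf_neq0 c0 d0) eAB) (base_change_clear hP c0 eA).
rewrite (base_change_clear hP d0 eB) => h.
apply: (@conv_prime _ _ P (tcoef^~ A) (tcoef^~ B)) => // [i j|l]; first exact: pr.
by rewrite -tcoefM.
Qed.

Lemma base_change_cap I (F : ({mpoly k[n]} -> Prop) -> Prop) : homogeneous_ideal I ->
  (forall P, F P -> homogeneous_ideal P) ->
  (forall f, (forall P, F P -> P f) -> I f) ->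
  forall f, (forall P, F P -> base_change ratfun_of P f) -> base_change ratfun_of I f.
Proof.
move=> hI hF capF f h; have [c [A [c0 eA]]] := clear_denominators f.
apply/(base_change_clear hI c0 eA) => i; apply: capF => P FP.
by have /(base_change_clear (hF P FP) c0 eA) := h P FP; apply.
Qed.

End RationalFunctions.

(** * Nullstellensatz and chains of irreducible closed sets *)

Section HPrime.
Variables (F : fieldType) (n : nat).
Implicit Types (Q : {mpoly F[n]} -> Prop).

Lemma hprime_exp Q d a t : hprime Q -> homogp d a -> Q (a ^+ t) -> Q a.
Proof.
move=> [Q1 pr] ha; elim: t => [|t IH]; first by rewrite expr0.
by rewrite exprS => /(pr _ _ _ _ ha (homogpXn t ha)) [].
Qed.

Lemma hprime_nzd Q d a : hprime Q -> homogp d a -> ~ Q a -> nzd Q a.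
Proof. by move=> [_ pr] ha Qa M b hb /(pr _ _ _ _ ha hb) []. Qed.

Lemma sumI0 Q (y : 'I_0 -> {mpoly F[n]}) f : sumI Q y f -> Q f.
Proof. by case=> a; rewrite big_ord0 subr0. Qed.

(** The nonzero polynomials in [y] form a multiplicative set that misses [Q]. *)
Lemma indep_over_hprime Q s (y : 'I_s -> {mpoly F[n]}) : homogeneous_ideal Q -> indep_over Q y ->
  exists Q', [/\ homogeneous_ideal Q', hprime Q', forall f, Q f -> Q' f & indep_over Q' y].
Proof.
move=> hQ iy; have [] := @hprime_avoiding _ _ Q (fun f => exists q, q != 0 /\ f = subst y q) hQ.
- by exists 1; rewrite oner_neq0 rmorph1.
- move=> _ _ [p [p0 ->]] [q [q0 ->]]; exists (p * q).
  by rewrite mulf_neq0 // rmorphM.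
- by move=> _ [q [q0 ->]] /iy e; rewrite e eqxx in q0.
move=> Q' [hQ' prQ' sub avoid _]; exists Q'; split=> // q Qq.
by apply/eqP/negP => /negP q0; apply: avoid Qq; exists q.
Qed.

Lemma indep_over_proper Q s (y : 'I_s -> {mpoly F[n]}) : indep_over Q y -> ~ Q 1.
Proof.
by move=> iy; rewrite -(rmorph1 (subst y)) => /iy/eqP; rewrite oner_eq0.
Qed.

Lemma indep_over_notin Q s (y : 'I_s -> {mpoly F[n]}) i : indep_over Q y -> ~ Q (y i).
Proof.
move=> iy; rewrite -(substU y i) => /iy/eqP.
by rewrite -msize_poly_eq0 msizeX.
Qed.

Hypothesis infF : infinite_field F.

(** A dependence among the remaining forms modulo [y ord0] would allow one fewer of them; with
    [y ord0] put back, [Q] would be finite over [s] forms although [s.+1] are independent. If no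
    form remains, the component of degree 0 shows that 1 stays outside. *)
Lemma indep_over_tail Q s (y : 'I_s.+1 -> {mpoly F[n]}) :
  homogeneous_ideal Q -> lin_forms y -> fin_over Q y -> indep_over Q y ->
  fin_over (sumI1 Q (y ord0)) (fun i => y (lift ord0 i)) /\
  indep_over (sumI1 Q (y ord0)) (fun i => y (lift ord0 i)).
Proof.
move=> hQ hy fy iy; have idQ := hid_ideal hQ.
set Q' := sumI1 Q (y ord0); set y' := fun i => y (lift ord0 i).
have hQ' : homogeneous_ideal Q' by apply: (sumI_homog (e := fun=> 1%N)).
have idQ' := hid_ideal hQ'.
have hy' : lin_forms y' by move=> i; apply: hy.
have fy' : fin_over Q' y'.
  case: fy => E fy; exists E => i; apply: (sumI_min (J := Q) (y := y)) (fy i).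
  - exact: sumI_ideal.
  - by move=> f Qf; do 2![apply: sumI_sub => //].
  move=> j; case: (unliftP ord0 j) => [l|] ->; first exact: (sumI_gen idQ' y' l).
  by apply: sumI_sub => //; exact: (sumI_gen idQ (fun=> y ord0) ord0).
split=> //; apply: NNPP => ny'.
case: s y hy fy iy @Q' @y' hQ' idQ' hy' fy' ny' => [|s] y hy fy iy Q' y' hQ' idQ' hy' fy' ny'.
  apply: ny'; apply: indep_over0 => // /sumI1P [a] /(hid_hcomp hQ 0).
  rewrite hcompB (hcomp_id (homogp1 _ _)) (hcompM_homogr _ _ (hy ord0)) /= subr0.
  exact: indep_over_proper iy.
have [z [hz fz]] := dependent_fin_over infF hQ' hy' fy' ny'.
pose u (i : 'I_s.+1) := if unlift ord0 i is Some j then z j else y ord0.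
have hu : lin_forms u by move=> i; rewrite /u; case: unlift.
have fu : fin_over Q u.
  case: fz => E fz; exists E => i.
  have idu : is_ideal (sumI Q u) by apply: sumI_ideal.
  apply: (sumI_min (J := Q') (y := z)) (fz i) => //; last first.
    by move=> j; have := sumI_gen idQ u (lift ord0 j); rewrite /u liftK.
  apply: sumI_min => //; first by move=> f; apply: sumI_sub.
  by move=> _; have := sumI_gen idQ u ord0; rewrite /u unlift_none.
have := fin_over_grows_lt hQ hu fu (indep_over_grows idQ hy iy).
by rewrite ltnn.
Qed.

End HPrime.

Section BinaryForms.
Variables (K : closedFieldType) (n : nat) (Q : {mpoly K[n]} -> Prop).
Hypotheses (hQ : homogeneous_ideal Q) (prQ : hprime Q).
Variables (x y : {mpoly K[n]}).
Hypotheses (hx : homogp 1 x) (hy : homogp 1 y) (Qy : ~ Q y).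

(** The homogenization of [p] to a binary form of degree [D] in [x] and [y]. *)
Definition bform D (p : {poly K}) : {mpoly K[n]} :=
  \sum_(j < D.+1) p`_j *: (x ^+ j * y ^+ (D - j)).

Lemma bform_homog D p : homogp D (bform D p).
Proof.
apply: homogp_sum => j _; apply: homogpZ.
have := homogpM (homogpXn j hx) (homogpXn (D - j) hy).
by rewrite !mul1n subnKC // -ltnS.
Qed.

Lemma bform_mulXsub D (p : {poly K}) r : (size p <= D.+1)%N ->
  bform D.+1 (p * ('X - r%:P)) = (x - r *: y) * bform D p.
Proof.
move=> sp; rewrite mulrBl /bform [in RHS]mulr_sumr [X in _ = _ - X]mulr_sumr.
under eq_bigr => j _ do rewrite mulrBr coefB coefMC scalerBl.
rewrite sumrB; congr (_ - _).
  rewrite big_ord_recl coefMX eqxx scale0r add0r; apply: eq_bigr => j _.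
  by rewrite coefMX /= subSS -scalerAr exprS mulrA.
rewrite big_ord_recr /= nth_default // mul0r scale0r addr0; apply: eq_bigr => j _.
have lt : (j <= D)%N by rewrite -ltnS.
by rewrite -scalerAr -scalerAl scalerA subSn // exprS mulrCA.
Qed.

(** Over a closed field the form splits into linear factors, and the prime [Q] contains one of them.
    Factors [y], present when [p] has degree below [D], are excluded by [Qy]. *)
Lemma bform_linear_factor D (p : {poly K}) : (size p <= D.+1)%N -> p != 0 -> Q (bform D p) ->
  exists r, Q (x - r *: y).
Proof.
elim: D p => [|D IH] p sp p0.
  rewrite /bform big_ord1 subnn !expr0 mulr1 => Qp; case: prQ => Q1 _; case: Q1.
  have c0 : p`_0 != 0.
    by apply: contraNneq p0 => e; rewrite (size1_polyC sp) e.
  by have := idZ (hid_ideal hQ) (p`_0)^-1 Qp; rewrite scalerA mulVf // scale1r.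
case: (leqP (size p) 1) => [s1|s1].
  have c0 : p`_0 != 0.
    by apply: contraNneq p0 => e; rewrite (size1_polyC s1) e.
  rewrite /bform big_ord_recl big1 ?addr0 => [Qp|j _]; last first.
    by rewrite nth_default ?scale0r // (leq_trans s1).
  case: Qy; apply: (hprime_exp prQ hy (t := D.+1)).
  have := idZ (hid_ideal hQ) (p`_0)^-1 Qp.
  by rewrite scalerA mulVf // scale1r expr0 mul1r subn0.
have [r /factor_theorem [p1 e]] : exists r, root p r by apply/closed_rootP; rewrite gtn_eqF.
have p10 : p1 != 0 by apply: contraNneq p0 => e'; rewrite e e' mul0r.
have sp1 : (size p1 <= D.+1)%N.
  by move: sp; rewrite e size_Mmonic ?monicXsubC // size_XsubC addn2.
rewrite e bform_mulXsub // => /(proj2 prQ 1%N D) [||Qr|Qp1].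
- by rewrite -scaleNr; apply: homogpD => //; apply: homogpZ.
- exact: bform_homog.
- by exists r.
exact: IH Qp1.
Qed.

Lemma bform_dependent : ~ indep_over Q (fun i : 'I_2 => if i == ord0 then y else x) ->
  exists r, Q (x - r *: y).
Proof.
set z := fun i => _; have hz : lin_forms z by move=> i; rewrite /z; case: ifP.
case/(dependent_homog hQ hz) => D [q [/homogpP hq q0 Qq]].
pose one : 'I_2 := lift ord0 ord0.
(* A monomial of degree [D] in two variables is determined by its exponent of [x], so setting [y] to
   1 loses nothing. *)
pose p : {poly K} := \sum_(m <- msupp q) q@_m *: 'X^(m one).
have m2 (m : 'X_{1..2}) : mdeg m = (m ord0 + m one)%N by rewrite mdegE !big_ord_recl big_ord0 addn0.
have mi (m m' : 'X_{1..2}) : mdeg m = D -> mdeg m' = D -> m one = m' one -> m = m'.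
  rewrite !m2 => e e' e1; apply/mnmP => i; case: (unliftP ord0 i) => [j|] ->.
    by rewrite (ord1 j).
  by apply: (@addIn (m one)); rewrite e e1.
have degq m : m \in msupp q -> mdeg m = D by rewrite mcoeff_msupp => /hq.
have p0 : p != 0.
  have lq := mlead_supp q0; apply/eqP => /(congr1 (fun p : {poly K} => p`_(mlead q one))).
  rewrite coef0 coef_sum (bigD1_seq (mlead q)) ?msupp_uniq //= coefZ coefXn eqxx mulr1.
  rewrite big_seq_cond big1 => [|m /andP[mq ne]].
    by rewrite addr0 => /eqP; rewrite mleadc_eq0 (negbTE q0).
  rewrite coefZ coefXn; case: eqP => [e|_]; last by rewrite mulr0.
  by case/eqP: ne; apply: mi; rewrite ?degq.
have lem m : m \in msupp q -> (m one <= D)%N by move=> /degq <-; rewrite m2 leq_addl.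
apply: (@bform_linear_factor D p) => //.
  rewrite /p big_seq; apply: leq_trans (size_sum _ _ _) _; apply/bigmax_leqP_seq => m mq _.
  by apply: leq_trans (size_scale_leq _ _) _; rewrite size_polyXn ltnS lem.
suff -> : bform D p = subst z q by [].
rewrite substE /bform /p; under eq_bigr => j _ do rewrite coef_sum scaler_suml.
rewrite exchange_big /= big_seq [RHS]big_seq; apply: eq_bigr => m mq.
have lt : (m one < D.+1)%N by rewrite ltnS lem.
rewrite (bigD1 (Ordinal lt)) //= coefZ coefXn eqxx mulr1 big1 ?addr0 => [|j ne].
  rewrite !big_ord_recl big_ord0 mulr1 /z /= mulrC -(degq m mq) m2 addnK.
  by [].
rewrite coefZ coefXn; case: eqP => [e|_]; last by rewrite mulr0 scale0r.
by case/eqP: ne; apply: val_inj.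
Qed.

End BinaryForms.

Section Nullstellensatz.
Variables (K : closedFieldType) (n : nat).
Implicit Types (Q : {mpoly K[n]} -> Prop) (f : {mpoly K[n]}).
Let infK := @closed_field_infinite K.

Lemma fin_over0_mem Q (y : 'I_0 -> {mpoly K[n]}) e f : homogeneous_ideal Q -> hprime Q ->
  fin_over Q y -> (0 < e)%N -> homogp e f -> Q f.
Proof.
move=> hQ prQ [E fE] e0 /homogpP hf; have idQ := hid_ideal hQ.
have QX i : Q 'X_i by apply: (hprime_exp prQ (homogp_X1 _ i) (t := E)); apply: sumI0 (fE i).
rewrite [f]mpolyE big_seq; apply: (id_sum idQ) => m; rewrite mcoeff_msupp => /hf dm.
apply: (idZ idQ).
have [i mi] : exists i, m i != 0%N.
  apply: NNPP => h; move: e0; rewrite -dm mdegE big1 // => i _.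
  by apply/eqP/negP => /negP mi; apply: h; exists i.
by rewrite -(submK (m := U_(i)%MM) (m' := m)) ?lep1mP // mpolyXD; apply: idMl.
Qed.

(** No form at all would put [f] in [Q]. With at least two, growth forces a relation [q] among the
    [y] modulo [Q] and [f]. By maximality a power of [f] lies in the ideal of [Q] and [z ord0], so a
    power of the relation lies in that of [Q] and [z]. Then [Q] is finite over the forms [z], one
    too few. *)
Lemma maximal_avoiding_power_dim1 Q e f s (y : 'I_s -> {mpoly K[n]}) :
  homogeneous_ideal Q -> hprime Q -> homogp e f -> (0 < e)%N -> ~ Q f ->
  (forall d a, homogp d a -> ~ Q a -> exists t, sumI1 Q a (f ^+ t)) ->
  lin_forms y -> fin_over Q y -> indep_over Q y -> s = 1%N.
Proof.
move=> hQ prQ hf e0 Qf maxQ; have idQ := hid_ideal hQ.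
case: s y => [|[//|s]] y hy fy iy; first by case: Qf; apply: fin_over0_mem fy e0 hf.
have hQf : homogeneous_ideal (sumI1 Q f) by apply: (sumI_homog (e := fun=> e)).
have nf : ~ indep_over (sumI1 Q f) y.
  move=> /(indep_over_grows (hid_ideal hQf) hy) gr.
  have gr' : grows s.+2 Q.
    apply: (growsS idQ (hid_ideal hQf) _ _ hf e0 (hprime_nzd prQ hf Qf) gr).
      by move=> g; apply: sumI_sub.
    exact: (sumI_gen idQ (fun=> f) ord0).
  by have := fin_over_grows_lt hQ hy fy gr'; rewrite ltnn.
have [D [q [hq q0 /sumI1P [a ha]]]] := dependent_homog hQf hy nf.
have [lam hlam] := sheared_fin_over n infK hq q0.
have hz := shear_lin_forms lam hy.
set z := shear lam y in hz; have Qz0 : ~ Q (z ord0).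
  have -> : z ord0 = subst y ('X_(lift ord0 ord0) - lam ord0 *: 'X_ord0).
    by rewrite rmorphB /= substZ !substU.
  move/iy => /(congr1 (mcoeff U_(lift ord0 ord0))).
  rewrite mcoeff0 mcoeffB mcoeffZ !mcoeffX eqxx.
  have -> : (U_(ord0) == U_(lift ord0 ord0) :> 'X_{1..s.+2})%MM = false by rewrite eq_mnm1.
  by rewrite mulr0 subr0 => /eqP; rewrite oner_eq0.
have [t /sumI1P [b hb]] := maxQ _ _ (hz ord0) Qz0.
have fz : fin_over Q z.
  apply: (hlam Q y t) => //.
  have idz : is_ideal (sumI Q z) by apply: sumI_ideal.
  have h1 := sumI_sub z (idB_exp idQ t ha); apply: (idB_mem idz h1).
  rewrite exprMn; apply: (idMl idz); apply: (idB_mem idz (sumI_sub z hb)).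
  by apply: (idMl idz); apply: sumI_gen.
by have := fin_over_grows_lt hQ hz fz (indep_over_grows idQ hy iy); lia.
Qed.

(* An ideal [Q'] above [Q] that is maximal among those containing no power of [f]
   has a one-dimensional quotient, so it is the ideal of a single projective point. *)
Lemma nullstellensatz Q e f : homogeneous_ideal Q -> hprime Q -> homogp e f -> (0 < e)%N ->
  ~ Q f -> exists v : 'I_n -> K,
    [/\ exists i, v i != 0, forall g, Q g -> g.@[v] = 0 & f.@[v] != 0].
Proof.
move=> hQ prQ hf e0 Qf.
have [] := @hprime_avoiding _ _ Q (fun g => exists t, g = f ^+ t) hQ.
- by exists 0%N; rewrite expr0.
- by move=> _ _ [t ->] [t' ->]; exists (t + t')%N; rewrite exprD.
- by move=> _ [t ->] /(hprime_exp prQ hf).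
move=> Q' [hQ' prQ' sub avoid maxQ].
have Q'f : ~ Q' f by apply: avoid; exists 1%N; rewrite expr1.
have idQ' := hid_ideal hQ'.
have maxQ' d a : homogp d a -> ~ Q' a -> exists t, sumI1 Q' a (f ^+ t).
  by move=> ha Qa; have [_ [[t ->] h]] := maxQ d a ha Qa; exists t.
have [s [y [hy fy iy]]] := noether_normalization infK hQ' (proj1 prQ').
have es := maximal_avoiding_power_dim1 hQ' prQ' hf e0 Q'f maxQ' hy fy iy.
subst s; set z := y ord0; have hz : homogp 1 z by apply: hy.
have Q'z : ~ Q' z by apply: indep_over_notin iy.
(* As [z] alone normalizes [Q'], it is dependent with each variable, which is then a multiple of
   [z]; the multipliers are the coordinates of the point. *)
have exv i : exists r, Q' ('X_i - r *: z).
  apply: (bform_dependent hQ' prQ' (homogp_X1 _ i) hz Q'z).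
  set u := fun j => _; have hu : lin_forms u.
    by move=> j; rewrite /u; case: ifP => // _; apply: homogp_X1.
  move=> /(indep_over_grows idQ' hu) gr.
  by have := fin_over_grows_lt hQ' hy fy gr.
pose v i := sval (constructive_indefinite_description _ (exv i)).
have hv i : Q' ('X_i - v i *: z) by exact: (svalP (constructive_indefinite_description _ (exv i))).
have ev d g : homogp d g -> Q' (g - g.@[v] *: z ^+ d).
  move=> hg; have := subst_congr g idQ' hv; rewrite (subst_scale _ _ hg).
  by rewrite subst_id.
have fv : f.@[v] != 0.
  by apply/eqP => e1; apply: Q'f; have := ev _ _ hf; rewrite e1 scale0r subr0.
exists v; split=> //.
  apply: NNPP => h; have v0 i : v i = 0 by apply/eqP/negP => /negP vi; apply: h; exists i.
  case/eqP: fv; rewrite (meval_eq _ (v2 := fun i => 0 * v i)) => [|i]; last by rewrite mul0r v0.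
  by rewrite (meval_scale _ _ hf) expr0n eqn0Ngt e0 mul0r.
move=> g Qg; rewrite (hcomp_sumE (leqnn (msize g))) raddf_sum big1 //= => d _.
apply/eqP/negP => /negP gv; apply: Q'z; apply: (hprime_exp prQ' hz (t := d)).
have := ev _ _ (hcomp_homog d g) => /(idB_sym idQ') h.
have := idB_mem idQ' h (sub _ (hid_hcomp hQ d Qg)) => /(idZ idQ' (hcomp d g).@[v]^-1).
by rewrite scalerA mulVf // scale1r.
Qed.

End Nullstellensatz.

Section Chains.
Variables (K : closedFieldType) (n : nat).
Implicit Types (Q : {mpoly K[n.+1]} -> Prop) (V W Z : pset K n).
Let infK := @closed_field_infinite K.

Lemma irr_chain_sub V W d : psubset V W -> irr_chain V d -> irr_chain W d.
Proof. by move=> VW [Z [h1 h2 h3]]; exists Z; split=> // v /h3; apply: VW. Qed.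

Lemma irr_chain_le V d e : (e <= d)%N -> irr_chain V d -> irr_chain V e.
Proof.
move=> /subnK <-; elim: (d - e)%N => // m IH [Z [h1 h2 h3]].
rewrite addSn in h1 h2 h3; apply: IH; exists Z; split.
- by move=> i le; apply: h1; apply: leqW.
- by move=> i lt; apply: h2; apply: leqW.
- by move=> v /(proj1 (h2 (m + e)%N (leqnn _))) /h3.
Qed.

Lemma proj_zero_sub (S T : {mpoly K[n.+1]} -> Prop) :
  (forall f, S f -> T f) -> psubset (proj_zero T) (proj_zero S).
Proof. by move=> sub v [v0 hv]; split=> // f /sub; apply: hv. Qed.

Lemma proj_zero_closed Q : homogeneous_ideal Q -> proj_closed (proj_zero Q).
Proof.
move=> hQ; exists (fun f => Q f /\ exists d, homogp d f); split=> [f []|v] //.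
split=> [[v0 hv]|[v0 hv]]; split=> // f; first by case=> /hv.
move=> Qf; rewrite (hcomp_sumE (leqnn (msize f))) raddf_sum big1 //= => d _.
apply: hv; split; first exact: hid_hcomp.
by exists d; apply: hcomp_homog.
Qed.

Lemma proj_zero_irreducible Q e f : homogeneous_ideal Q -> hprime Q -> homogp e f ->
  (0 < e)%N -> ~ Q f -> proj_irreducible (proj_zero Q).
Proof.
move=> hQ prQ hf e0 Qf; split; first exact: proj_zero_closed.
  by have [v [v0 hv _]] := nullstellensatz hQ prQ hf e0 Qf; exists v.
move=> Y1 Y2 [S1 [hS1 eY1]] [S2 [hS2 eY2]] cov.
have wit Y S : (forall v, Y v <-> proj_zero S v) -> (forall g, S g -> exists d, homogp d g) ->
    ~ psubset (proj_zero Q) Y -> exists d g, [/\ homogp d g, S g & ~ Q g].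
  move=> eY hS /not_forall_exists [v nv]; have [[v0 hv] nYv] := imply_to_and _ _ nv.
  apply: NNPP => h; apply: nYv; apply/eY; split=> // g Sg.
  by apply: hv; apply: NNPP => Qg; have [d hg] := hS _ Sg; apply: h; exists d, g.
apply: NNPP => /not_or_and [n1 n2].
have [d1 [g1 [hg1 Sg1 Qg1]]] := wit _ _ eY1 hS1 n1.
have [d2 [g2 [hg2 Sg2 Qg2]]] := wit _ _ eY2 hS2 n2.
have hg := homogpM hg1 hg2; have h := homogpM hg hf.
have Qh : ~ Q (g1 * g2 * f).
  move=> /(proj2 prQ _ _ _ _ hg hf) [] // /(proj2 prQ _ _ _ _ hg1 hg2) [] //.
have [|v [v0 hv]] := nullstellensatz hQ prQ h _ Qh; first by rewrite addn_gt0 e0 orbT.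
rewrite !mevalM !mulf_eq0 !negb_or -andbA => /and3P[g1v g2v _].
case: (cov v); first by split.
  by move=> /eY1 [_ /(_ _ Sg1) e1]; rewrite e1 eqxx in g1v.
by move=> /eY2 [_ /(_ _ Sg2) e2]; rewrite e2 eqxx in g2v.
Qed.

(** The top of the chain is the zero set of a prime [Q1] above [Q] that keeps [y] independent; the
    rest comes by induction from the section [y ord0 = 0]. Strictness holds as the Nullstellensatz
    finds a zero of [Q1] where [y ord0] does not vanish. *)
Lemma indep_over_chain s Q (y : 'I_s.+1 -> {mpoly K[n.+1]}) : homogeneous_ideal Q ->
  lin_forms y -> fin_over Q y -> indep_over Q y -> irr_chain (proj_zero Q) s.
Proof.
elim: s Q y => [|s IH] Q y hQ hy fy iy.
all: have [Q1 [hQ1 prQ1 sub iy1]] := indep_over_hprime hQ iy.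
all: have fy1 : fin_over Q1 y by case: fy => E h; exists E => i; apply: (sumI_mono sub).
all: have Q1y : ~ Q1 (y ord0) by apply: indep_over_notin iy1.
all: have irr := proj_zero_irreducible hQ1 prQ1 (hy ord0) (leqnn 1) Q1y.
  by exists (fun=> proj_zero Q1); split=> //; apply: proj_zero_sub.
have [fy2 iy2] := indep_over_tail infK hQ1 hy fy1 iy1.
have hQ2 : homogeneous_ideal (sumI1 Q1 (y ord0)) by apply: (sumI_homog (e := fun=> 1%N)).
have [|Z [Zirr Zincr Zs]] := IH _ _ hQ2 _ fy2 iy2; first by move=> i; apply: hy.
have idQ1 := hid_ideal hQ1.
have ZQ1 : psubset (Z s) (proj_zero Q1).
  by move=> v /Zs; apply: proj_zero_sub => f; apply: sumI_sub.
exists (fun i => if (i <= s)%N then Z i else proj_zero Q1); split.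
- by move=> i _; case: ifP => // /Zirr.
- move=> i lti; have [->|lt] : i = s \/ (i < s)%N by lia.
    2: by rewrite lt (ltnW lt); apply: Zincr.
  rewrite leqnn ltnn; split=> // sub'.
  have [v [v0 hv /eqP yv]] := nullstellensatz hQ1 prQ1 (hy ord0) (leqnn 1) Q1y.
  apply: yv; have [_] := Zs v (sub' v (conj v0 hv)); apply.
  exact: (sumI_gen idQ1 (fun=> y ord0) ord0).
by rewrite ltnn; apply: proj_zero_sub.
Qed.

Lemma grows_chain Q r : homogeneous_ideal Q -> grows r Q -> irr_chain (proj_zero Q) r.
Proof.
move=> hQ gr; have Q1 : ~ Q 1.
  move=> Q1; have fy : fin_over Q (fun i : 'I_0 => 0).
    by exists 0%N => i; rewrite expr0; apply: sumI_sub => //; exact: hid_ideal.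
  have := fin_over_grows_lt hQ _ fy gr; rewrite ltn0.
  by move=> h; have : false by apply: h => -[].
have [s [y [hy fy iy]]] := noether_normalization infK hQ Q1.
case: s y hy fy iy => [|s] y hy fy iy; first by have := fin_over_grows_lt hQ hy fy gr.
apply: (irr_chain_le (d := s)); last exact: indep_over_chain iy.
by rewrite -ltnS; apply: fin_over_grows_lt gr.
Qed.

(** Asking every component to vanish makes the ideal homogeneous without using that [Z] is stable
    under scaling. *)
Definition vanishing (Z : pset K n) : {mpoly K[n.+1]} -> Prop :=
  fun f => forall v d, Z v -> (hcomp d f).@[v] = 0.

Lemma vanishing_homog Z : homogeneous_ideal (vanishing Z).
Proof.
split; last first.
  move=> f d hf v e Zv; case: (eqVneq d e) => [<-|ne].
    by rewrite hcomp_id ?hcomp_homog //; apply: hf.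
  by rewrite (hcomp_ne (hcomp_homog d f) ne) meval0.
split=> [v d _|f g hf hg v d Zv|f g hf v d Zv]; first by rewrite hcomp0 meval0.
  by rewrite hcompD mevalD hf // hg // addr0.
rewrite hcompM raddf_sum big1 //= => i _.
by rewrite mevalM hf // mulr0.
Qed.

Lemma vanishingP Z d f : homogp d f -> (vanishing Z f <-> forall v, Z v -> f.@[v] = 0).
Proof.
move=> hf; split=> [h v Zv|h v e Zv]; first by rewrite -(hcomp_id hf); apply: h.
case: (eqVneq d e) => [<-|ne]; first by rewrite hcomp_id //; apply: h.
by rewrite (hcomp_ne hf ne) meval0.
Qed.

Lemma proj_irreducible_nonzero Z v : proj_irreducible Z -> Z v -> exists i, v i != 0.
Proof. by move=> [[S [_ eZ]] _ _] /eZ []. Qed.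

Lemma vanishing_hprime Z : proj_irreducible Z -> hprime (vanishing Z).
Proof.
move=> irr; have [[S [hS eZ]] [v0 Zv0] cov] := irr; split.
  by move=> /(vanishingP _ (homogp1 _ _))/(_ v0 Zv0)/eqP; rewrite meval1 oner_eq0.
move=> d e a b ha hb /(vanishingP _ (homogpM ha hb)) hab.
have cl c (g : {mpoly K[n.+1]}) : homogp c g -> proj_closed (proj_zero (eq g)).
  by move=> hg; exists (eq g); split=> // _ <-; exists c.
case: (cov _ _ (cl _ _ ha) (cl _ _ hb)).
- move=> v Zv; have := hab v Zv; rewrite mevalM => /eqP; rewrite mulf_eq0.
  have nz := proj_irreducible_nonzero irr Zv.
  by case/orP => /eqP h; [left|right]; split=> // _ <-.
- by move=> h; left; apply/(vanishingP _ ha) => v /h [_]; apply.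
- by move=> h; right; apply/(vanishingP _ hb) => v /h [_]; apply.
Qed.

Lemma vanishing_grows0 Z : proj_irreducible Z -> grows 0 (vanishing Z).
Proof.
move=> irr; have [_ [v Zv] _] := irr; have [i vi] := proj_irreducible_nonzero irr Zv.
exists 1%N; split=> // M; rewrite mul1n bin0 -[X in (X <= _)%N](card_ord 1).
have hX : homogp M ('X_i ^+ M : {mpoly K[n.+1]}).
  by rewrite -[X in homogp X]mul1n; apply/homogpXn/homogp_X1.
apply: (indep_fam_le (hid_ideal (vanishing_homog Z)) (p := fun=> 'X_i ^+ M)).
split=> // c; rewrite big_ord1 => /(vanishingP _ (homogpZ _ hX))/(_ v Zv)/eqP.
rewrite mevalZ rmorphXn /= mevalXU mulf_eq0 (negbTE (expf_neq0 _ vi)) orbF => /eqP c0 j.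
by rewrite (ord1 j).
Qed.

(** An equation of [Z] that fails at a point of [Z'] is a nonzero divisor modulo the prime
    [vanishing Z'], so [growsS] applies. *)
Lemma vanishing_growsS Z Z' r : proj_irreducible Z -> proj_irreducible Z' ->
  psubset Z Z' -> ~ psubset Z' Z -> grows r (vanishing Z) -> grows r.+1 (vanishing Z').
Proof.
move=> irr irr' sub /not_forall_exists [v nv]; have [Z'v nZv] := imply_to_and _ _ nv.
have [[S [hS eZ]] [u Zu] _] := irr.
have [f [Sf fv]] : exists f, S f /\ f.@[v] != 0.
  apply: NNPP => h; apply: nZv; apply/eZ; split; first exact: proj_irreducible_nonzero Z'v.
  by move=> f Sf; apply/eqP/negP => /negP fv; apply: h; exists f.
have [d hd] := hS _ Sf.
have Zf w : Z w -> f.@[w] = 0 by move=> /eZ [_]; apply.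
(* A form of degree 0 takes one value everywhere: scaling by 0 sends [u] and [v] to the same vector,
   so [f] would vanish at [v] as it does at [u]. *)
have d0 : (0 < d)%N.
  rewrite lt0n; apply: contraNneq fv => d0; rewrite d0 in hd.
  have fC w : f.@[w] = 1 * f.@[w] by rewrite mul1r.
  rewrite -(meval_eq f (v1 := fun i => 1 * v i)) => [|i]; last by rewrite mul1r.
  have e w : f.@[fun i => 0 * w i] = f.@[w].
    by rewrite (meval_scale _ _ hd) expr0 mul1r.
  rewrite (meval_scale _ _ hd) expr0 mul1r -e.
  by rewrite (meval_eq f (v2 := fun i => 0 * u i)) ?e ?Zf // => i; rewrite !mul0r.
have nf : ~ vanishing Z' f by move=> /(vanishingP _ hd)/(_ v Z'v)/eqP; apply/negP.
have idv W := hid_ideal (vanishing_homog W).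
apply: (growsS (idv Z') (idv Z) _ _ hd d0 (hprime_nzd (vanishing_hprime irr') hd nf)).
  by move=> g h w e Zw; apply: h; apply: sub.
by apply/(vanishingP _ hd).
Qed.

Lemma chain_vanishing_grows (Z : nat -> pset K n) d :
  (forall i, (i <= d)%N -> proj_irreducible (Z i)) ->
  (forall i, (i < d)%N -> psubset (Z i) (Z i.+1) /\ ~ psubset (Z i.+1) (Z i)) ->
  grows d (vanishing (Z d)).
Proof.
move=> irr incr; suff h i : (i <= d)%N -> grows i (vanishing (Z i)) by exact: h.
elim: i => [|i IH] le; first exact: vanishing_grows0 (irr _ _).
have [s1 s2] := incr i le.
by apply: vanishing_growsS s1 s2 (IH _); [apply: irr; apply: ltnW | apply: irr | apply: ltnW].
Qed.

End Chains.

(** * Projective dimension over the base field *)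

Section Dimension.
Variables (k : fieldType) (K : closedFieldType) (iota : {rmorphism k -> K}) (n : nat).
Implicit Types (I : {mpoly k[n.+1]} -> Prop).

Lemma grows_irr_chain I r : homogeneous_ideal I -> grows r I -> irr_chain (proj_variety iota I) r.
Proof.
move=> hI gr; have hE := base_change_homog iota hI.
apply: irr_chain_sub (grows_chain hE (base_change_grows iota hI gr)).
by apply: proj_zero_sub => _ [f [If ->]]; apply: base_change_map.
Qed.

Lemma hcomp_map_mpoly d (f : {mpoly k[n.+1]}) :
  hcomp d (map_mpoly iota f) = map_mpoly iota (hcomp d f).
Proof.
apply/mpolyP => m; rewrite mcoeff_map_mpoly !mcoeff_hcomp mcoeff_map_mpoly.
by case: ifP => // _; exact/esym/rmorph0.
Qed.

Lemma vanishing_map I Z f : homogeneous_ideal I -> psubset Z (proj_variety iota I) ->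
  I f -> vanishing Z (map_mpoly iota f).
Proof.
move=> hI sub If v d /sub [_]; apply; exists (hcomp d f); split; first exact: hid_hcomp.
exact: hcomp_map_mpoly.
Qed.

Lemma irr_chain_grows I d : homogeneous_ideal I -> irr_chain (proj_variety iota I) d -> grows d I.
Proof.
move=> hI [Z [irr incr sub]]; have [e [e0 gr]] := chain_vanishing_grows irr incr.
exists e; split=> // M; apply: leq_trans (gr M) _.
apply: (hilbert_map_le (iota := iota)) => //; first exact/hid_ideal/vanishing_homog.
by move=> f; apply: vanishing_map.
Qed.

End Dimension.

(** * Chardin's bound *)

Section TailOrder.
Variables (F : fieldType) (d : nat).
Implicit Types (p q : {mpoly F[d.+1]}) (m : 'X_{1..d.+1}).

(* The order of vanishing at the point [(1 : 0 : ... : 0)] of a monomial. *)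
Definition tdeg m : nat := (mdeg m - m ord0)%N.

Lemma mdeg_head m : mdeg m = (m ord0 + \sum_(i < d.+1 | i != ord0) m i)%N.
Proof. by rewrite mdegE (bigD1 ord0). Qed.

Lemma tdegE m : (mdeg m = m ord0 + tdeg m)%N.
Proof. by rewrite subnKC // mdegE (bigD1 ord0) //= leq_addr. Qed.

Lemma tdegD m m' : tdeg (m + m')%MM = (tdeg m + tdeg m')%N.
Proof. by have := tdegE (m + m')%MM; rewrite mdegD mnmDE !tdegE; lia. Qed.

Lemma tdeg_U0 c : tdeg (U_(ord0) *+ c)%MM = 0%N.
Proof. by rewrite /tdeg mdegMn mdeg1 mulmnE mnm1E eqxx subnn. Qed.

Lemma tdeg_eq m m' : mdeg m = mdeg m' -> (forall i, i != ord0 -> m i = m' i) -> m = m'.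
Proof.
move=> e h; apply/mnmP => i; case: (eqVneq i ord0) => [->|]; last exact: h.
by move: e; rewrite !mdeg_head (eq_bigr m') => [/addIn|j /h].
Qed.

Lemma tdeg0 m : tdeg m = 0%N -> m = (U_(ord0) *+ mdeg m)%MM.
Proof.
move=> t0; apply: tdeg_eq => [|i ne]; first by rewrite mdegMn mdeg1 mul1n.
rewrite mulmnE mnm1E eq_sym (negbTE ne) mul0n; apply/eqP; rewrite -leqn0.
by rewrite -t0 /tdeg mdegE (bigD1 ord0) //= addKn (bigD1 i) //= leq_addr.
Qed.

Definition ordge e q : Prop := forall m, q@_m != 0 -> (e <= tdeg m)%N.

Lemma ordge_lin e c p q : ordge e p -> ordge e q -> ordge e (c *: p + q).
Proof.
move=> hp hq m; rewrite mcoeffD mcoeffZ; case: (eqVneq p@_m 0) => [->|/hp //].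
by rewrite mulr0 add0r => /hq.
Qed.

Lemma ordge_sum e (T : Type) (r : seq T) (P : pred T) (f : T -> {mpoly F[d.+1]}) :
  (forall i, P i -> ordge e (f i)) -> ordge e (\sum_(i <- r | P i) f i).
Proof.
move=> h; elim/big_ind: _ => // [m|p q hp hq]; first by rewrite mcoeff0 eqxx.
by rewrite -[p]scale1r; apply: ordge_lin.
Qed.

Lemma ordge_mul e e' p q : ordge e p -> ordge e' q -> ordge (e + e') (p * q).
Proof.
move=> hp hq m; rewrite -mcoeff_msupp => /msuppM_le /allpairsP [[m1 m2] /= [h1 h2 ->]].
by rewrite tdegD leq_add // ?hp ?hq // -mcoeff_msupp.
Qed.

Lemma ordge0 q : ordge 0 q. Proof. by []. Qed.

Lemma ordge_small D e q : homogp D q -> (D < e)%N -> ordge e q -> q = 0.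
Proof.
move=> /homogpP hq lt h; apply/mpolyP => m; rewrite mcoeff0; apply/eqP/negP => /negP qm.
by have := h _ qm; have := hq _ qm; rewrite tdegE; lia.
Qed.

(** A monomial of [q] of least tail degree, times the power of ['X_ord0] in [b], survives in
    [b * q], since all other terms of [b] raise the tail degree. *)
Lemma ordge_cancel e c b q : homogp c b -> b@_(U_(ord0) *+ c) != 0 ->
  ordge e (b * q) -> ordge e q.
Proof.
move=> /homogpP hb b0 h m qm.
have [t [[m1 [qm1 tm1]] min]] :=
  @least_nat (fun t => exists m, q@_m != 0 /\ tdeg m = t) (tdeg m) (ex_intro _ m (conj qm erefl)).
have qt : ordge t q by move=> m' qm'; rewrite leqNgt; apply/negP => /min; apply; exists m'.
apply: leq_trans (qt _ qm); have := h (m1 + U_(ord0) *+ c)%MM.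
rewrite tdegD tdeg_U0 addn0 tm1; apply.
set beta := b@_(U_(ord0) *+ c) in b0.
pose b' := b - beta *: 'X_[U_(ord0) *+ c].
have hb' : ordge 1 b'.
  move=> m'; rewrite mcoeffB mcoeffZ mcoeffX; case: (eqVneq _ m') => [<-|ne].
    by rewrite mulr1 subrr eqxx.
  rewrite mulr0 subr0 => /hb dm; rewrite lt0n; apply: contraNneq ne => /tdeg0.
  by rewrite dm => ->.
have -> : b * q = beta *: (q * 'X_[U_(ord0) *+ c]) + b' * q.
  by rewrite mulrBl -scalerAl ['X_[_] * q]mulrC [RHS]addrC subrK.
rewrite mcoeffD mcoeffZ addmC mcoeffMX.
have -> : (b' * q)@_(U_(ord0) *+ c + m1) = 0; last by rewrite addr0 mulf_neq0.
apply/eqP/negP => /negP /(ordge_mul hb' qt).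
by rewrite tdegD tdeg_U0 tm1 add0n add1n ltnn.
Qed.

(** Only the exponent of ['X_ord0] changes. Monomials of a fixed degree with tail degree at most m
    thus embed into monomials of degree m, whence C(m + d, d) conditions per coordinate. *)
Definition retail D m : 'X_{1..d.+1} :=
  [multinom if i == ord0 then (D - tdeg m)%N else m i | i < d.+1].

Lemma retail_deg D m : (tdeg m <= D)%N -> mdeg (retail D m) = D.
Proof.
move=> le; have := tdegE m; rewrite !mdeg_head mnmE eqxx => /addnI e.
by rewrite (eq_bigr m) ?e ?subnK // => i ne; rewrite mnmE (negbTE ne).
Qed.

Lemma retail_retail D D' m : (tdeg m <= D)%N -> mdeg m = D' -> retail D' (retail D m) = m.
Proof.
move=> le dm; apply: tdeg_eq => [|i ne]; last by rewrite !mnmE (negbTE ne).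
have e : tdeg (retail D m) = tdeg m.
  by have := tdegE (retail D m); rewrite retail_deg // mnmE eqxx; lia.
by rewrite retail_deg // e -dm tdegE leq_addl.
Qed.

End TailOrder.

Section Core.
Variables (F : fieldType) (n d : nat) (J : {mpoly F[n]} -> Prop).
Variables (y : 'I_d.+1 -> {mpoly F[n]}) (T : finType) (e : T -> {mpoly F[n]}).
Variables (dg : T -> nat) (c : nat) (b : {mpoly F[d.+1]}).
Hypotheses (hJ : homogeneous_ideal J) (he : forall t, homogp (dg t) (e t)).
Hypotheses (hb : homogp c b) (b0 : b@_(U_(ord0) *+ c) != 0).
Hypothesis ind : forall q : T -> {mpoly F[d.+1]},
  J (\sum_t subst y (q t) * e t) -> forall t, q t = 0.

(** As [M + c - dg t] is truncated, the vanishing of coordinates of negative degree is required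
    apart. *)
Definition coords M (f : {mpoly F[n]}) (q : T -> {mpoly F[d.+1]}) : Prop :=
  (forall t, homogp (M + c - dg t) (q t) /\ ((M + c < dg t)%N -> q t = 0)) /\
  J (subst y b * f - \sum_t subst y (q t) * e t).

Hypothesis gen : forall M f, homogp M f -> exists q, coords M f q.
Hypothesis torsion_free : forall a, J (subst y b * a) -> J a.
Hypothesis reduced : forall a s, J (a ^+ s) -> J a.
Let idJ := hid_ideal hJ.

Lemma coords_uniq (q q' : T -> {mpoly F[d.+1]}) :
  J (\sum_t subst y (q t) * e t - \sum_t subst y (q' t) * e t) -> forall t, q t = q' t.
Proof.
move=> h t; apply/eqP; rewrite -subr_eq0; apply/eqP.
apply: (ind (q := fun t => q t - q' t)).
under eq_bigr => i _ do rewrite rmorphB /= mulrBl.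
by rewrite sumrB.
Qed.

(** Expanding (b a)(b a') b in the products [e i * e j], and b times these in their coordinates
    [g i j], gives [b ^+ 2 * r t = r' t]. The right side has order at least [E + E'], and cancelling
    [b] twice does not lower the order. *)
Lemma coords_mul_ord M M' a a' q q' r E E' : coords M a q -> coords M' a' q' ->
  (forall t, ordge E (q t)) -> (forall t, ordge E' (q' t)) ->
  J (subst y b * (a * a') - \sum_t subst y (r t) * e t) ->
  forall t, ordge (E + E') (r t).
Proof.
move=> [_ jq] [_ jq'] oq oq' jr.
have exg (ij : T * T) : exists g, coords (dg ij.1 + dg ij.2) (e ij.1 * e ij.2) g.
  by apply: gen; apply: homogpM.
pose g i j := sval (constructive_indefinite_description _ (exg (i, j))).
have jg i j : J (subst y b * (e i * e j) - \sum_t subst y (g i j t) * e t).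
  by have [_ h] := svalP (constructive_indefinite_description _ (exg (i, j))).
pose r' t := \sum_i \sum_j q i * q' j * g i j t.
have er : forall t, b ^+ 2 * r t = r' t.
  apply: (coords_uniq (q := fun t => b ^+ 2 * r t) (q' := r')).
  apply: (idB_trans idJ (g := subst y b ^+ 2 * (subst y b * (a * a')))).
    have -> : \sum_t subst y (b ^+ 2 * r t) * e t = subst y b ^+ 2 * \sum_t subst y (r t) * e t.
      by rewrite mulr_sumr; apply: eq_bigr => t _; rewrite substM rmorphXn mulrA.
    by rewrite -mulrBr; apply: (idMl idJ); apply: (idB_sym idJ).
  have -> : subst y b ^+ 2 * (subst y b * (a * a')) =
      (subst y b * a) * (subst y b * a') * subst y b.
    by ring.
  apply: (idB_trans idJ (idB_mul idJ (idB_mul idJ jq jq') (idB_refl idJ (subst y b)))).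
  have -> : (\sum_t subst y (q t) * e t) * (\sum_t subst y (q' t) * e t) * subst y b =
      \sum_i \sum_j (subst y (q i) * subst y (q' j)) * (subst y b * (e i * e j)).
    rewrite mulr_suml mulr_suml; apply: eq_bigr => i _.
    rewrite mulr_sumr mulr_suml; apply: eq_bigr => j _.
    by ring.
  have -> : \sum_t subst y (r' t) * e t =
      \sum_i \sum_j (subst y (q i) * subst y (q' j)) * (\sum_t subst y (g i j t) * e t).
    under eq_bigr => t _ do rewrite /r' subst_sum mulr_suml.
    rewrite exchange_big; apply: eq_bigr => i _.
    under eq_bigr => t _ do rewrite subst_sum mulr_suml.
    rewrite exchange_big; apply: eq_bigr => j _.
    by rewrite mulr_sumr; apply: eq_bigr => t _; rewrite !substM !mulrA.
  apply: (idB_sum idJ) => i _; apply: (idB_sum idJ) => j _.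
  rewrite -mulrBr; apply: (idMl idJ); exact: jg.
move=> t; apply: (ordge_cancel hb b0); apply: (ordge_cancel hb b0).
rewrite mulrA -expr2 er; apply: ordge_sum => i _; apply: ordge_sum => j _.
by rewrite -[(E + E')%N]addn0; apply: ordge_mul => //; apply: ordge_mul.
Qed.

Lemma coords_exp_ord M a q E s r : homogp M a -> coords M a q -> (forall t, ordge E (q t)) ->
  J (subst y b * a ^+ s - \sum_t subst y (r t) * e t) -> forall t, ordge (E * s) (r t).
Proof.
move=> ha cq oq; elim: s r => [|s IH] r jr t; first by rewrite muln0; apply: ordge0.
have [r' cr'] := gen (homogpXn s ha).
rewrite mulnS; apply: (coords_mul_ord cq cr') t => //; last by rewrite -exprS.
by apply: IH; case: cr'.
Qed.

(* A nonzero multiple of [a ^+ s] has coordinates of degree at most [M * s + c], while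
   their order is at least [M.+1 * s], which is too large as soon as [c < s]. *)
Lemma high_order_zero M a q : homogp M a -> coords M a q -> (forall t, ordge M.+1 (q t)) -> J a.
Proof.
move=> ha cq oq; apply: (reduced (s := c.+1)); apply: torsion_free.
have [r [hr jr]] := gen (homogpXn c.+1 ha).
have or := coords_exp_ord ha cq oq jr.
apply: (idB_mem idJ jr); rewrite big1 => [|t _]; first exact: id0.
rewrite (ordge_small (proj1 (hr t)) _ (or t)) ?rmorph0 ?mul0r //.
by rewrite mulSn; lia.
Qed.

(** With more independent forms than conditions, a nontrivial combination has coordinates of order
    at least [m.+1], and [high_order_zero] puts it in [J]. *)
Lemma hilbert_le_core m : (hilbert_fun J m <= #|T| * 'C(m + d, d))%N.
Proof.
have [p [hp ip]] := indep_hilbert J m; rewrite leqNgt; apply/negP => lt.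
pose q i := sval (constructive_indefinite_description _ (gen (hp i))).
have cq i : coords m (p i) (q i) by exact: (svalP (constructive_indefinite_description _ (gen (hp i)))).
(* The rows collect all coefficients of tail degree at most [m], indexed by monomials of degree [m]
   through [retail]. *)
pose A i (x : T * seq_sub (monos d.+1 m)) := (q i x.1)@_(retail (m + c - dg x.1) (ssval x.2)).
have [|u [[i ui] uA]] := @row_dependency _ _ _ A.
  by rewrite card_prod card_monos card_ord.
case/eqP: ui; apply: ip; apply: (@high_order_zero m _ (fun t => \sum_i u i *: q i t)).
- by apply: homogp_sum => j _; apply: homogpZ.
- split=> [t|].
    split; first by apply: homogp_sum => j _; apply: homogpZ; case: (cq j) => /(_ t) [].
    move=> lt'; rewrite big1 // => j _; case: (cq j) => /(_ t) [_ ->] //.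
    by rewrite scaler0.
  have -> : \sum_t subst y (\sum_i u i *: q i t) * e t = \sum_i u i *: \sum_t subst y (q i t) * e t.
    under eq_bigr => t _ do rewrite subst_sum mulr_suml.
    rewrite exchange_big; apply: eq_bigr => j _; rewrite scaler_sumr; apply: eq_bigr => t _.
    by rewrite /= substZ scalerAl.
  rewrite mulr_sumr; apply: (idB_sum idJ) => j _.
  by rewrite -scalerAr -scalerBr; apply: (idZ idJ); case: (cq j).
move=> t mu qmu; rewrite ltnNge; apply/negP => le; case/eqP: qmu.
case: (classic (mdeg mu = (m + c - dg t)%N)) => dmu; last first.
  rewrite raddf_sum big1 //= => j _; rewrite mcoeffZ.
  suff -> : (q j t)@_mu = 0 by rewrite mulr0.
  apply/eqP/negP => /negP qm; apply: dmu; case: (cq j) => /(_ t) [/homogpP h _] _.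
  exact: h.
have mon : retail m mu \in monos d.+1 m by rewrite mem_monos retail_deg.
rewrite -(uA (t, SeqSub mon)) raddf_sum; apply: eq_bigr => j _.
by rewrite /= mcoeffZ /A /= retail_retail.
Qed.

End Core.

Lemma subst_comp (F : comNzRingType) r s n (y : 'I_s -> {mpoly F[n]}) (z : 'I_r -> {mpoly F[s]}) q :
  subst y (subst z q) = subst (fun i => subst y (z i)) q.
Proof.
rewrite [in RHS]substE [subst z q]substE raddf_sum; apply: eq_bigr => m _.
by rewrite /= substZ rmorph_prod; congr (_ *: _); apply: eq_bigr => i _; rewrite rmorphXn.
Qed.

Lemma eq_subst (F : comNzRingType) s n (y z : 'I_s -> {mpoly F[n]}) q :
  y =1 z -> subst y q = subst z q.
Proof.
move=> e; rewrite !substE; apply: eq_bigr => m _; congr (_ *: _).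
by apply: eq_bigr => i _; rewrite e.
Qed.

Lemma meval_subst (F : comNzRingType) s n (y : 'I_s -> {mpoly F[n]}) q v :
  (subst y q).@[v] = q.@[fun i => (y i).@[v]].
Proof.
rewrite [RHS]mevalE substE rmorph_sum; apply: eq_bigr => m _.
by rewrite /= mevalZ rmorph_prod; congr (_ * _); apply: eq_bigr => i _; rewrite rmorphXn.
Qed.

Section Translation.
Variables (F : fieldType) (d : nat) (v : 'I_d.+1 -> F).

(* Moves the point [(1, 0, ..., 0)] to [v] when [v ord0 = 1]. *)
Definition point_subst (i : 'I_d.+1) : {mpoly F[d.+1]} :=
  'X_i + (if i == ord0 then 0 else v i) *: 'X_ord0.
Definition point_subst_inv (i : 'I_d.+1) : {mpoly F[d.+1]} :=
  'X_i - (if i == ord0 then 0 else v i) *: 'X_ord0.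

Lemma point_subst_lin i : homogp 1 (point_subst i).
Proof. by apply: homogpD; [|apply: homogpZ]; apply: homogp_X1. Qed.

Lemma point_substK q : subst point_subst_inv (subst point_subst q) = q.
Proof.
rewrite subst_comp -[RHS]subst_id; apply: eq_subst => i.
by rewrite raddfD /= substZ !substU /point_subst_inv eqxx scale0r subr0 subrK.
Qed.

Lemma point_substVK q : subst point_subst (subst point_subst_inv q) = q.
Proof.
rewrite subst_comp -[RHS]subst_id; apply: eq_subst => i.
by rewrite raddfB /= substZ !substU /point_subst eqxx scale0r addr0 addrK.
Qed.

Lemma mcoeff_homog_point c (p : {mpoly F[d.+1]}) : homogp c p ->
  p.@[fun i => (i == ord0)%:R] = p@_(U_(ord0) *+ c).
Proof.
move=> /homogpP hp; rewrite mevalE.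
have E (m : 'X_{1..d.+1}) : mdeg m = c ->
    \prod_i ((i == ord0)%:R : F) ^+ m i = (m == (U_(ord0) *+ c)%MM)%:R.
  move=> dm; case: (eqVneq m (U_(ord0) *+ c)%MM) => [->|ne].
    rewrite big1 // => i _; rewrite mulmnE mnm1E eq_sym.
    by case: eqP; rewrite ?expr1n ?mul0n ?expr0.
  have [i [ni mi]] : exists i, i != ord0 /\ m i != 0%N.
    apply: NNPP => h; case/eqP: ne; apply: tdeg_eq => [|i ni].
      by rewrite mdegMn mdeg1 mul1n.
    rewrite mulmnE mnm1E eq_sym (negbTE ni) mul0n; apply/eqP/negP => /negP mi.
    by apply: h; exists i.
  by rewrite (bigD1 i) //= (negbTE ni) expr0n (negbTE mi) mul0r.
rewrite big_seq (eq_bigr (fun m => p@_m * (m == (U_(ord0) *+ c)%MM)%:R)); last first.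
  by move=> m; rewrite mcoeff_msupp => /hp /E ->.
rewrite -big_seq [in RHS](mpolyE p) raddf_sum; apply: eq_bigr => m _.
by rewrite /= mcoeffZ mcoeffX.
Qed.

Lemma mcoeff_point_subst c (p : {mpoly F[d.+1]}) : v ord0 = 1 -> homogp c p ->
  (subst point_subst p)@_(U_(ord0) *+ c) = p.@[v].
Proof.
move=> v0 hp; rewrite -mcoeff_homog_point; last exact: (subst_homog point_subst_lin).
rewrite meval_subst; apply: meval_eq => i.
rewrite mevalD mevalZ !mevalXU eqxx mulr1; case: eqP => [->|_]; first by rewrite v0 addr0.
by rewrite add0r.
Qed.

End Translation.

Section Chardin.
Variables (F : fieldType) (n d : nat) (J : {mpoly F[n]} -> Prop).
Variables (y : 'I_d.+1 -> {mpoly F[n]}).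
Hypotheses (infF : infinite_field F) (hJ : homogeneous_ideal J) (hy : lin_forms y).
Hypothesis fy : fin_over J y.
Hypothesis torsion_free : forall q a, q != 0 -> J (subst y q * a) -> J a.
Hypothesis reduced : forall a s, J (a ^+ s) -> J a.
Let idJ := hid_ideal hJ.

Definition indep_set (T : finType) (e : T -> {mpoly F[n]}) (A : {set T}) : Prop :=
  forall q : T -> {mpoly F[d.+1]},
    J (\sum_(t in A) subst y (q t) * e t) -> forall t, t \in A -> q t = 0.

Lemma maximal_indep_set (T : finType) (e : T -> {mpoly F[n]}) :
  exists A : {set T}, indep_set e A /\ forall t, exists b q, b != 0 /\
    J (subst y b * e t - \sum_(u in A) subst y (q u) * e u).
Proof.
have ind0 : pb (indep_set e set0) by apply/pbP => q _ t; rewrite inE.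
case: (@arg_maxnP _ set0 (fun A => pb (indep_set e A)) (fun A : {set T} => #|A|) ind0).
move=> A /pbP iA maxA; exists A; split=> // t; case: (boolP (t \in A)) => [tA|tA].
  exists 1, (fun u => (u == t)%:R); rewrite oner_neq0; split=> //.
  rewrite (bigD1 t) //= eqxx rmorph1 mul1r big1 ?addr0 ?subrr; first exact: id0.
  by move=> u /andP[_ /negbTE ->]; rewrite raddf0 mul0r.
have : ~ indep_set e (t |: A).
  by move=> iA'; have := maxA _ (introT (pbP _) iA'); rewrite /= cardsU1 tA add1n ltnn.
case/not_forall_exists => q nq; have [jq nq'] := imply_to_and _ _ nq.
have qt : q t != 0.
  apply/eqP => qt; apply: nq' => u; rewrite inE => /orP[/set1P -> //|].
  by apply: iA; move: jq; rewrite big_setU1 //= qt raddf0 mul0r add0r.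
exists (q t), (fun u => - q u); split=> //.
move: jq; rewrite big_setU1 //=; congr (J (_ + _)); rewrite -sumrN.
by apply: eq_bigr => u _; rewrite raddfN /= mulNr opprK.
Qed.

Lemma common_denominator : exists (T : finType) (e : T -> {mpoly F[n]}) (dg : T -> nat)
    (c : nat) (b : {mpoly F[d.+1]}),
  [/\ forall t, homogp (dg t) (e t), homogp c b, b != 0,
     forall q : T -> {mpoly F[d.+1]}, J (\sum_t subst y (q t) * e t) -> forall t, q t = 0 &
     forall M f, homogp M f -> exists q, coords J y e dg c b M f q].
Proof.
have [E fE] := fy.
pose e (g : {ffun 'I_n -> 'I_E}) : {mpoly F[n]} := 'X_[boxm g].
have [A [iA maxA]] := maximal_indep_set e.
have [b [q [b0 jb]]] : exists (b : {ffun 'I_n -> 'I_E} -> {mpoly F[d.+1]})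
    (q : {ffun 'I_n -> 'I_E} -> {ffun 'I_n -> 'I_E} -> {mpoly F[d.+1]}),
    (forall g, b g != 0) /\
    forall g, J (subst y (b g) * e g - \sum_(u in A) subst y (q g u) * e u).
  have exb g : {bq : _ * _ | bq.1 != 0 /\
      J (subst y bq.1 * e g - \sum_(u in A) subst y (bq.2 u) * e u)}.
    apply: constructive_indefinite_description.
    by have [b [q h]] := maxA g; exists (b, q).
  exists (fun g => (sval (exb g)).1), (fun g => (sval (exb g)).2).
  by split=> g; case: (svalP (exb g)).
pose B := \prod_g b g; have B0 : B != 0 by apply/prodf_neq0 => g _.
(* The product of the denominators need not be homogeneous; any nonzero component serves, because
   [J] and the [e g] are homogeneous. *)
have [c Bc] : exists c, hcomp c B != 0.
  apply: NNPP => h; case/eqP: B0; rewrite (hcomp_sumE (leqnn (msize B))) big1 // => i _.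
  by apply/eqP/negP => /negP h'; apply: h; exists i.
pose T := {x in A}; pose e' (t : T) := e (val t); pose dg (t : T) := mdeg (boxm (val t)).
exists T, e', dg, c, (hcomp c B); split=> //.
- by move=> t; apply: homogpX.
- exact: hcomp_homog.
- move=> r jr t.
  pose r' g := if insub g is Some t then r t else 0.
  have er (u : T) : r' (val u) = r u by rewrite /r' valK.
  rewrite -er; apply: iA; last exact: (valP t).
  rewrite (big_sub A (fun g => subst y (r' g) * e g)).
  by under eq_bigr => u _ do rewrite er.
move=> M f hf; have [g [_ jg]] := fin_over_gen hJ hy fE hf.
pose r u := \sum_x g x * (\prod_(x' | x' != x) b x') * q x u.
have jr : J (subst y B * f - \sum_(u in A) subst y (r u) * e u).
  apply: (idB_trans idJ (g := subst y B * \sum_x subst y (g x) * e x)).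
    by rewrite -mulrBr; apply: (idMl idJ).
  have -> : \sum_(u in A) subst y (r u) * e u =
      \sum_x subst y (g x * \prod_(x' | x' != x) b x') * \sum_(u in A) subst y (q x u) * e u.
    under eq_bigr => u _ do rewrite subst_sum mulr_suml.
    rewrite exchange_big; apply: eq_bigr => x _; rewrite mulr_sumr; apply: eq_bigr => u _.
    by rewrite !substM mulrA.
  rewrite mulr_sumr; apply: (idB_sum idJ) => x _.
  have -> : subst y B * (subst y (g x) * e x) =
      subst y (g x * \prod_(x' | x' != x) b x') * (subst y (b x) * e x).
    have swap (u1 u2 u3 u4 : {mpoly F[n]}) : (u1 * u2) * (u3 * u4) = (u3 * u2) * (u1 * u4) by ring.
    have -> : B = b x * \prod_(x' | x' != x) b x' by rewrite /B (bigD1 x).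
    rewrite [subst y (b x * _)]substM [subst y (g x * _)]substM; exact: swap.
  rewrite -mulrBr; apply: (idMl idJ); exact: jb.
exists (fun t => if (dg t <= M + c)%N then hcomp (M + c - dg t) (r (val t)) else 0); split.
  move=> t; case: leqP => [le|lt]; last by split=> //; apply: homogp0.
  by split; first exact: hcomp_homog.
have := hid_hcomp hJ (M + c) jr.
rewrite hcompB (hcompM_homogr _ _ hf) leq_addr addKn hcomp_subst //.
congr (J (_ - _)); rewrite hcomp_sum (big_sub A (fun u => hcomp (M + c) (subst y (r u) * e u))).
apply: eq_bigr => t _; rewrite (hcompM_homogr _ _ (homogpX _ (boxm (val t)))) -/(dg t).
by case: leqP => [le|lt]; rewrite ?hcomp_subst // raddf0 mul0r.
Qed.

(** [D] is the rank of the free module spanned by [e]. The lower bound counts the multiples of its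
    basis by monomials, shifted by powers of ['X_ord0] into the common degree [M + c]; the sum of
    all [dg t] is a simple [c] that is at least each of them. *)
Lemma chardin_bound : exists D c, (forall m, (hilbert_fun J m <= D * 'C(m + d, d))%N) /\
  (forall M, (D * 'C(M + d, d) <= hilbert_fun J (M + c))%N).
Proof.
have [T [e [dg [c [b [he hb b0 ind gen]]]]]] := common_denominator.
exists #|T|, (\sum_t dg t)%N; split=> [m|M].
  (* Coordinates are moved so that [v], where [b] is nonzero, becomes the point (1 : 0 : ... :
     0). *)
  have [v [v0 bv]] := homog_nonzero_at1 infF hb b0.
  pose y' i := subst y (point_subst_inv v i).
  have ey' q : subst y' q = subst y (subst (point_subst_inv v) q) by rewrite subst_comp.
  apply: (@hilbert_le_core F n d J y' T e dg c (subst (point_subst v) b) hJ he _ _ _ _ _ reduced).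
  - exact: (subst_homog (@point_subst_lin _ _ v)).
  - by rewrite mcoeff_point_subst.
  - move=> q jq t.
    have E : \sum_t subst y' (q t) * e t = \sum_t subst y (subst (point_subst_inv v) (q t)) * e t.
      by apply: eq_bigr => u _; rewrite ey'.
    rewrite E in jq; have z := ind (fun t => subst (point_subst_inv v) (q t)) jq t.
    by rewrite -(point_substVK v (q t)) z; apply: raddf0.
  - move=> N f hf; have [q [hq jq]] := gen N f hf.
    exists (fun t => subst (point_subst v) (q t)); split=> [t|].
      have [h1 h2] := hq t; split; first exact: (subst_homog (@point_subst_lin _ _ v)).
      by move/h2 ->; rewrite raddf0.
    have E : \sum_t subst y' (subst (point_subst v) (q t)) * e t = \sum_t subst y (q t) * e t.
      by apply: eq_bigr => t _; rewrite ey' point_substK.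
    by rewrite E ey' point_substK.
  - by move=> a; rewrite ey' point_substK; apply: torsion_free.
set N := (\sum_t dg t)%N; have dgN t : (dg t <= N)%N by rewrite /N (bigD1 t) //= leq_addr.
rewrite -card_monos -card_prod.
pose sh (x : T * seq_sub (monos d.+1 M)) := (ssval x.2 + U_(ord0) *+ (N - dg x.1))%MM.
apply: (indep_fam_le idJ (p := fun x : T * seq_sub (monos d.+1 M) => subst y 'X_[sh x] * e x.1)).
split=> [[t nu]|a ja].
  have -> : (M + N = mdeg (sh (t, nu)) + dg t)%N.
    rewrite /sh mdegD mdegMn mdeg1 mul1n /= -addnA subnK //.
    by have := ssvalP nu; rewrite mem_monos => /eqP ->.
  by apply: homogpM; [apply: (subst_homog hy); apply: homogpX | apply: he].
pose q t := \sum_(nu : seq_sub (monos d.+1 M)) a (t, nu) *: ('X_[sh (t, nu)] : {mpoly F[d.+1]}).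
have q0 : forall t, q t = 0.
  apply: ind; have <- : \sum_x a x *: (subst y 'X_[sh x] * e x.1) = \sum_t subst y (q t) * e t.
    transitivity (\sum_t \sum_nu a (t, nu) *: (subst y 'X_[sh (t, nu)] * e t)).
      by rewrite pair_bigA; apply: eq_bigr => -[t nu] _.
    apply: eq_bigr => t _; rewrite /q subst_sum mulr_suml; apply: eq_bigr => nu _.
    by rewrite substZ scalerAl.
  exact: ja.
move=> [t nu]; have := congr1 (mcoeff (sh (t, nu))) (q0 t).
rewrite mcoeff0 raddf_sum /= (bigD1 nu) //= mcoeffZ mcoeffX eqxx mulr1 big1 ?addr0 // => nu' ne.
rewrite mcoeffZ mcoeffX /sh /= eqm_add2r (inj_eq val_inj) (negbTE ne).
by rewrite mulr0.
Qed.

End Chardin.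

(** * Hilbert polynomials *)

Section EventuallyNonneg.
Implicit Types (p q : {poly rat}).

(** A bound away from 0, and not mere negativity, is what the induction on [q * 'X + c%:P] can use:
    for large x the term [- e * x] outweighs [c]. *)
Lemma lead_coef_neg_eventually p : lead_coef p < 0 ->
  exists M e : rat, 0 < e /\ forall x, M <= x -> p.[x] <= - e.
Proof.
elim/poly_ind: p => [|q c IH]; first by rewrite lead_coef0 ltxx.
have [->|q0] := eqVneq q 0.
  rewrite mul0r add0r lead_coefC => c0; exists 0, (- c); split; first by rewrite oppr_gt0.
  by move=> x _; rewrite hornerC opprK.
have -> : lead_coef (q * 'X + c%:P) = lead_coef q.
  rewrite lead_coefDl ?lead_coefMX // size_polyC size_mulX //.
  by rewrite ltnS (leq_trans (leq_b1 _)) // size_poly_gt0.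
case/IH => M [e [e0 h]]; exists (Num.max M (Num.max 0 ((c + e) / e))), e; split=> // x.
rewrite !ge_max => /and3P[Mx x0 cx]; rewrite hornerD hornerM hornerX hornerC.
have h1 : q.[x] * x <= - e * x by apply: ler_wpM2r (h _ Mx).
have h2 : c + e <= x * e by rewrite -ler_pdivrMr.
lra.
Qed.

Definition eventually_nonneg p : Prop :=
  exists m0 : nat, forall m : nat, (m0 <= m)%N -> 0 <= p.[m%:R].

Lemma eventually_nonneg_coef p d : eventually_nonneg p -> (size p <= d.+1)%N -> 0 <= p`_d.
Proof.
move=> [m0 h] sp; rewrite leNgt; apply/negP => pd.
have lc : lead_coef p = p`_d.
  suff e : size p = d.+1 by rewrite /lead_coef e.
  apply/eqP; rewrite eqn_leq sp ltnNge; apply: contraTN pd => le.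
  by rewrite nth_default ?ltxx.
rewrite -lc in pd; have [M [e [e0 hM]]] := lead_coef_neg_eventually pd.
pose x := maxn m0 (Num.bound `|M|).
have := h x; rewrite leq_maxl => /(_ isT); apply/negP; rewrite -ltNge.
apply: le_lt_trans (hM x%:R _) _; last by rewrite oppr_lt0.
apply: le_trans (ler_norm _) _; apply: ltW; apply: lt_le_trans (archi_boundP (normr_ge0 _)) _.
by rewrite ler_nat leq_maxr.
Qed.

Lemma coef_comp_shift p (c : rat) d : (size p <= d.+1)%N -> (p \Po ('X + c%:P))`_d = p`_d.
Proof.
move=> sp; rewrite comp_polyE coef_sum.
have mon i : ('X + c%:P) ^+ i \is monic by apply: monic_exp; exact: monicXaddC.
have sz i : size (('X + c%:P) ^+ i) = i.+1.
  have := size_exp ('X + c%:P) i; rewrite size_XaddC mul1n => e.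
  by rewrite -[in RHS]e prednK // size_poly_gt0 monic_neq0.
rewrite (eq_bigr (fun i : 'I_(size p) => if (i == d :> nat) then p`_d else 0)); last first.
  move=> i _; rewrite coefZ; case: (ltngtP i d) => [lt|gt|->].
  - by rewrite [_`_d]nth_default ?mulr0 // sz.
  - by have := leq_trans (ltn_ord i) sp; rewrite ltnS leqNgt gt.
  - by have := monicP (mon d); rewrite /lead_coef sz /= => ->; rewrite mulr1.
rewrite -big_mkcond /=; case: (ltnP d (size p)) => [lt|le].
  by rewrite (big_pred1 (Ordinal lt)).
rewrite big_pred0 ?nth_default // => i; apply/negbTE/eqP => e.
by move: le; rewrite -e leqNgt ltn_ord.
Qed.

End EventuallyNonneg.

Definition bin_poly (d : nat) : {poly rat} := (d`!%:R)^-1 *: \prod_(i < d) ('X + (i.+1)%:R%:P).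

Lemma bin_poly_nat d m : (bin_poly d).[m%:R] = 'C(m + d, d)%:R.
Proof.
rewrite /bin_poly hornerZ horner_prod.
have -> : \prod_(i < d) ('X + (i.+1)%:R%:P).[m%:R : rat] = ((m + d) ^_ d)%:R.
  elim: d => [|d IH]; first by rewrite big_ord0 ffactn0.
  rewrite big_ord_recr IH /= hornerD hornerX hornerC -natrD -natrM addnS ffactSS.
  by rewrite mulnC.
by rewrite -bin_ffact natrM mulrC mulfK // pnatr_eq0 -lt0n fact_gt0.
Qed.

Lemma size_bin_poly d : (size (bin_poly d) <= d.+1)%N.
Proof.
apply: leq_trans (size_scale_leq _ _) _; rewrite size_prod => [|i _]; last first.
  by rewrite -size_poly_eq0 size_XaddC.
rewrite (eq_bigr (fun=> 2%N)) => [|i _]; last by rewrite size_XaddC.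
by rewrite sum_nat_const card_ord; lia.
Qed.

Lemma coef_bin_poly d : (d`!)%:R * (bin_poly d)`_d = 1.
Proof.
rewrite /bin_poly coefZ mulrA mulfV ?mul1r; last by rewrite pnatr_eq0 -lt0n fact_gt0.
have mon : \prod_(i < d) ('X + (i.+1)%:R%:P : {poly rat}) \is monic.
  by apply: monic_prod => i _; apply: monicXaddC.
have sz : size (\prod_(i < d) ('X + (i.+1)%:R%:P : {poly rat})) = d.+1.
  rewrite size_prod => [|i _]; last by rewrite -size_poly_eq0 size_XaddC.
  rewrite (eq_bigr (fun=> 2%N)) => [|i _]; last by rewrite size_XaddC.
  by rewrite sum_nat_const card_ord; lia.
by have := monicP mon; rewrite /lead_coef sz.
Qed.

(** [HP] lies below [U], its shift by [c] lies above, and a shift preserves the top coefficient, so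
    [HP] and [U] agree at any index bounding both degrees. Taken at the degree of [HP] this excludes
    a degree above [d]; taken at [d] it gives the claim. *)
Lemma poly_between_binomials (h : nat -> nat) (HP : {poly rat}) D c d m0 :
  (forall m, (m0 <= m)%N -> (h m)%:R = HP.[m%:R]) ->
  (forall m, (h m <= D * 'C(m + d, d))%N) ->
  (forall m, (D * 'C(m + d, d) <= h (m + c))%N) ->
  (d`!)%:R * HP`_d = D%:R.
Proof.
move=> hHP up low; pose U := D%:R *: bin_poly d.
have Un m : U.[m%:R] = (D * 'C(m + d, d))%:R by rewrite hornerZ bin_poly_nat natrM.
have sU : (size U <= d.+1)%N by apply: leq_trans (size_scale_leq _ _) (size_bin_poly d).
pose V := HP \Po ('X + c%:R%:P).
have r1 : eventually_nonneg (U - HP).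
  by exists m0 => m le; rewrite hornerD hornerN Un -hHP // subr_ge0 ler_nat.
have r2 : eventually_nonneg (V - U).
  exists m0 => m le; rewrite hornerD hornerN Un horner_comp hornerD hornerX hornerC -natrD.
  by rewrite -hHP ?subr_ge0 ?ler_nat // (leq_trans le) ?leq_addr.
have top N : (size HP <= N.+1)%N -> (size U <= N.+1)%N -> HP`_N = U`_N.
  move=> sH sU'; have sV : (size V <= N.+1)%N.
    apply: leq_trans (size_comp_poly_leq _ _) _.
    by rewrite size_XaddC muln1; move: sH; case: (size HP).
  have sz (p q : {poly rat}) : (size p <= N.+1)%N -> (size q <= N.+1)%N -> (size (p - q)%R <= N.+1)%N.
    by move=> hp hq; rewrite (leq_trans (size_polyD _ _)) // geq_max size_polyN hp.
  have := eventually_nonneg_coef r1 (sz _ _ sU' sH).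
  have := eventually_nonneg_coef r2 (sz _ _ sV sU').
  rewrite !coefB coef_comp_shift // !subr_ge0 => le1 le2.
  by apply/eqP; rewrite eq_le le1 le2.
suff sH : (size HP <= d.+1)%N.
  by rewrite top // coefZ mulrCA coef_bin_poly mulr1.
rewrite leqNgt; apply/negP => lt; pose N := (size HP).-1.
have sN : (size HP = N.+1)%N by rewrite /N prednK // (leq_trans _ lt).
have := top N; rewrite sN leqnn (leq_trans sU) -?sN 1?ltnW // => /(_ isT isT).
rewrite [U`_N]nth_default; last by rewrite (leq_trans sU) // -ltnS -sN.
by move/eqP; rewrite -/(lead_coef HP) lead_coef_eq0 -size_poly_eq0 sN.
Qed.

(** By Pascal's rule the difference of the binomials with lower index [d.+1] is the sum of C(m + i +
    d, d) over i < [D], and each term is at least C(m + d, d). *)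
Lemma mul_bin_le D m d : (D * 'C(m + d, d) + 'C(m + d, d.+1) <= 'C(m + D + d, d.+1))%N.
Proof.
elim: D => [|D IH]; first by rewrite mul0n add0n addn0.
rewrite addnS addSn binS mulSn -addnA addnC; apply: leq_add IH _.
by apply: leq_bin2l; rewrite leq_add2r leq_addr.
Qed.

(** * Unmixed radical ideals *)

Section Main.
Variables (k : fieldType) (K : closedFieldType) (iota : {rmorphism k -> K}) (n : nat).
Variables (I : {mpoly k[n.+1]} -> Prop) (d : nat).
Hypotheses (hI : homogeneous_ideal I) (radI : radical_ideal I) (unmI : unmixed iota I).
Hypothesis dimI : ideal_dim iota I d.
Let idI := hid_ideal hI.

Lemma pullback_homog (Q : {mpoly K[n.+1]} -> Prop) : homogeneous_ideal Q ->
  homogeneous_ideal (fun f => Q (map_mpoly iota f)).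
Proof.
move=> hQ; have idQ := hid_ideal hQ; split; last first.
  by move=> f e Qf; rewrite -hcomp_map_mpoly; apply: hid_hcomp.
split=> [|f g Qf Qg|f g Qf]; first by rewrite rmorph0; apply: id0.
  by rewrite rmorphD; apply: idD.
by rewrite rmorphM; apply: idMl.
Qed.

Lemma pullback_hprime (Q : {mpoly K[n.+1]} -> Prop) : hprime Q ->
  hprime (fun f => Q (map_mpoly iota f)).
Proof.
move=> [Q1 pr]; split; first by rewrite rmorph1.
move=> e e' a b ha hb; rewrite rmorphM; apply: (pr e e'); exact: map_mpoly_homog.
Qed.

(** The polynomials over [k] that vanish on the top of a chain of length [d] form a homogeneous
    prime above [I]. The variety of an associated prime below it contains that chain, and no longer
    one, as it lies inside the variety of [I]. *)
Lemma associated_prime_full_dim : exists P,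
  [/\ associated_prime I P, homogeneous_ideal P & ideal_dim iota P d].
Proof.
have [[Z [irr incr sub]] nchain] := dimI.
pose C f := vanishing (Z d) (map_mpoly iota f).
have hZ := irr d (leqnn d).
have hC : homogeneous_ideal C by apply/pullback_homog/vanishing_homog.
have prC : hprime C by apply/pullback_hprime/vanishing_hprime.
have [P [aP hP IP PC]] := associated_prime_below hI hC prC (fun f => vanishing_map hI sub).
exists P; split=> //; split.
  exists Z; split=> // v Zv; split; first exact: proj_irreducible_nonzero Zv.
  move=> _ [f [Pf ->]]; rewrite (hcomp_sumE (leqnn (msize (map_mpoly iota f)))).
  by rewrite raddf_sum big1 //= => e _; apply: PC.
apply: contra_not nchain; apply: irr_chain_sub; apply: proj_zero_sub.
by move=> _ [f [If ->]]; exists f; split=> //; apply: IP.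
Qed.

(** Unmixedness transfers the dimension [d] from one associated prime to all, and a chain of that
    length gives growth. *)
Lemma associated_prime_grows P : associated_prime I P -> homogeneous_ideal P -> grows d P.
Proof.
move=> aP hP; have [P0 [aP0 hP0 dimP0]] := associated_prime_full_dim.
by apply: (irr_chain_grows (iota := iota) hP); case/(unmI aP0 aP): dimP0.
Qed.

Lemma associated_prime_sup P f : associated_prime I P -> I f -> P f.
Proof. by case=> _ [g h] If; apply/h; apply: (idMr idI). Qed.

(** If [f] is outside the radical ideal [I], so are its powers; hence some homogeneous prime above
    [I] avoids [f], and so does an associated prime below it. *)
Lemma associated_primes_cap f :
  (forall P, associated_prime I P /\ homogeneous_ideal P -> P f) -> I f.
Proof.
move=> h; apply: NNPP => nIf; have [_ rad] := radI.
have [] := @hprime_avoiding _ _ I (fun g => exists t, g = f ^+ t) hI.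
- by exists 0%N; rewrite expr0.
- by move=> _ _ [t ->] [t' ->]; exists (t + t')%N; rewrite exprD.
- by move=> _ [t ->] /rad.
move=> Q [hQ prQ sub avoid _]; have [P [aP hP _ PQ]] := associated_prime_below hI hQ prQ sub.
by apply: (avoid f); [exists 1%N; rewrite expr1 | apply: PQ; apply: h].
Qed.

Lemma unmixed_hilbert_bound : exists D c,
  (forall m, (hilbert_fun I m <= D * 'C(m + d, d))%N) /\
  (forall m, (D * 'C(m + d, d) <= hilbert_fun I (m + c))%N).
Proof.
have [L [tof [tof_inj tof_denom]]] := ratfun_exists k.
have infL := ratfun_infinite tof_inj.
pose J := base_change (ratfun_of tof) I.
have hJ : homogeneous_ideal J by apply: base_change_homog.
(* The homogeneous associated primes already intersect in [I]. *)
pose Fam P := associated_prime I P /\ homogeneous_ideal P.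
have bcJ P : Fam P -> forall f, J f -> base_change (ratfun_of tof) P f.
  by move=> [aP _]; apply: base_change_sub => f; apply: associated_prime_sup.
have bcP P : Fam P -> prime_ideal (base_change (ratfun_of tof) P).
  by move=> [[prP _] hP]; apply: (base_change_prime tof_inj tof_denom).
have capJ := base_change_cap tof_inj tof_denom hI (F := Fam) (fun P FP => proj2 FP)
  associated_primes_cap.
have J1 : ~ J 1.
  have [P [aP hP _]] := associated_prime_full_dim.
  by have [_ P1 _] := bcP P (conj aP hP); move/(bcJ _ (conj aP hP)).
have [chain nchain] := dimI.
have hilbJ M : hilbert_fun J M = hilbert_fun I M by apply: hilbert_base_change.
have [s [y [hy fy iy]]] := noether_normalization infL hJ J1.
have ds : (d < s)%N.
  by apply: (fin_over_grows_lt hJ hy fy); apply/base_change_grows/(irr_chain_grows hI chain).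
case: s y hy fy iy ds => // s y hy fy iy ds.
(* More than [d.+1] independent forms would give growth, hence a chain, beyond [d]. *)
have sd : s = d.
  apply/eqP; rewrite eqn_leq -(ltnS d) ds andbT leqNgt; apply/negP => lt; apply: nchain.
  apply: (irr_chain_le lt); apply: grows_irr_chain => //.
  have [e [e0 gr]] := indep_over_grows (hid_ideal hJ) hy iy.
  by exists e; split=> // M; rewrite -hilbJ.
subst s.
(* The extension of [P] still grows with exponent [d], so it cannot be finite over the [d] forms
   that a dependence would leave. This is where unmixedness enters. *)
have indP P : Fam P -> indep_over (base_change (ratfun_of tof) P) y.
  move=> FP; apply: NNPP => nind; have [aP hP] := FP.
  have hE := base_change_homog (ratfun_of tof) hP.
  have fE : fin_over (base_change (ratfun_of tof) P) y.
    by case: fy => E h; exists E => i; apply: (sumI_mono (bcJ P FP)).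
  have [z [hz fz]] := dependent_fin_over infL hE hy fE nind.
  have gr := base_change_grows (ratfun_of tof) hP (associated_prime_grows aP hP).
  by have := fin_over_grows_lt hE hz fz gr; rewrite ltnn.
(* A nonzero polynomial in [y] lies in none of the extended primes, whose intersection is [J]. *)
have tf q a : q != 0 -> J (subst y q * a) -> J a.
  move=> q0 h; apply: capJ => P FP; have [_ _ pr] := bcP P FP.
  by case: (pr _ _ (bcJ P FP _ h)) => // /(indP P FP)/eqP; rewrite (negbTE q0).
have red a t : J (a ^+ t) -> J a.
  move=> h; apply: capJ => P FP; have [_ P1 pr] := bcP P FP.
  have {h} := bcJ P FP _ h; elim: t => [|t IH]; first by rewrite expr0.
  by rewrite exprS => /pr [].
have [D [c [up low]]] := chardin_bound infL hJ hy fy tf red.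
by exists D, c; split=> m; rewrite -hilbJ.
Qed.

End Main.

Theorem theorem2p2 (k : fieldType) (K : closedFieldType) (iota : {rmorphism k -> K})
  (n : nat) (I : {mpoly k[n.+1]} -> Prop) (d : nat) (HP : {poly rat}) (degI : nat) :
  perfect_field k ->
  algebraic_over iota ->
  homogeneous_ideal I ->
  radical_ideal I ->
  unmixed iota I ->
  ideal_dim iota I d ->
  hilbert_poly I HP ->
  (degI%:R = (d`!)%:R * HP`_d :> rat) ->
  forall m : nat, (1 <= m)%N ->
    (hilbert_fun I m <= 'C(m + degI + d, d.+1) - 'C(m + d, d.+1))%N.
Proof.
move=> _ _ hI radI unmI dimI [m0 hHP] hdeg m _.
have [D [c [up low]]] := unmixed_hilbert_bound hI radI unmI dimI.
have e : degI = D.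
  by apply/eqP; rewrite -(eqr_nat rat) hdeg (poly_between_binomials hHP up low).
rewrite e leq_subRL; first by rewrite addnC (leq_trans _ (mul_bin_le D m d)) // leq_add2r.
by apply: leq_bin2l; rewrite leq_add2r leq_addr.
Qed.
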